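(* Let $\mathcal{H}$ be a separable Hilbert space and let $\Psi=(\psi_\eta)_{\eta\in\mathbb{R}^2}\subset\mathcal{H}$ be a continuous Parseval frame on $\mathbb{R}^2$ with Lebesgue measure ($\eta\mapsto\psi_\eta$ weakly measurable and $\|f\|^2=\int_{\mathbb{R}^2}|\langle f,\psi_\eta\rangle|^2d\eta$ for all $f\in\mathcal{H}$). Let $R(\nu,\eta)=\langle\psi_\eta,\psi_\nu\rangle$ and $K^{(\eta,\nu)}(\rho)=R(\eta,\rho)R(\rho,\nu)$ for $\eta,\nu,\rho\in\mathbb{R}^2$, and assume that $K^{(\eta,\nu)}$ has continuous mixed partial derivatives $\partial_1K^{(\eta,\nu)},\partial_2K^{(\eta,\nu)},\partial_{12}K^{(\eta,\nu)}$ for almost all $\eta,\nu\in\mathbb{R}^2$. Define $$\Omega(\Psi)=\operatorname*{ess\,sup}_{\nu\in\mathbb{R}^2}\int_{\mathbb{R}^2}\Bigl[\|\partial_1K^{(\eta,\nu)}\|_{L^1}+\|\partial_2K^{(\eta,\nu)}\|_{L^1}+\|\partial_{12}K^{(\eta,\nu)}\|_{L^1}\Bigr]d\eta,$$ with $L^1$-norms over $\mathbb{R}^2$. Let $\Lambda\subset\mathbb{R}^2$ be a discrete set with $N_\rho:=\#(\Lambda\cap([0,1]^2+\rho))\ge1$ for all $\rho\in\mathbb{R}^2$, let $a_\lambda=\int_{\mathbb{R}^2}\chi_{[0,1]^2+\rho}(\lambda)/N_\rho\,d\rho$ for $\lambda\in\Lambda$, and let $$\mathcal{D}^*_{\mathrm{shift}}(\Lambda)=\sup_{\rho\in\mathbb{R}^2}\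 \sup_{\eta\in[0,1]^2}\left|\frac{\#(\Lambda\cap(\rho+[0,\eta]))}{N_\rho}-\mu([0,\eta])\right|.$$ If $\mathcal{D}^*_{\mathrm{shift}}(\Lambda)\,\Omega(\Psi)<1$, then $(\sqrt{a_\lambda}\,\psi_\lambda)_{\lambda\in\Lambda}$ is a discrete frame for $\mathcal{H}$ with frame bounds $1-\mathcal{D}^*_{\mathrm{shift}}(\Lambda)\Omega(\Psi)$ and $1+\mathcal{D}^*_{\mathrm{shift}}(\Lambda)\Omega(\Psi)$.
   Context: $\mu$ is Lebesgue measure, $\chi_M$ the characteristic function of $M$, $[0,\eta]=[0,\eta_1]\times[0,\eta_2]$. A family $(\phi_\lambda)$ is a frame with bounds $A,B$ if $A\|f\|^2\le\sum_\lambda|\langle f,\phi_\lambda\rangle|^2\le B\|f\|^2$ for all $f\in\mathcal{H}$. *)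

(* Defs.v *)
From HB Require Import structures.
From mathcomp Require Import all_boot all_order all_algebra.
From mathcomp Require Import all_classical all_reals all_analysis.
From mathcomp Require Import ess_sup_inf finmap.
From mathcomp Require Import complex.
Set Implicit Arguments. Unset Strict Implicit. Unset Printing Implicit Defensive.
Import Order.TTheory GRing.Theory Num.Theory.
Import numFieldNormedType.Exports.
Local Open Scope classical_set_scope.
Local Open Scope ring_scope.

Definition cRe {R : realType} (z : R[i]) : R := complex.Re z.
Definition cIm {R : realType} (z : R[i]) : R := complex.Im z.

Definition cabs2 {R : realType} (z : R[i]) : R := (cRe z) ^+ 2 + (cIm z) ^+ 2.
Definition cabs {R : realType} (z : R[i]) : R := Num.sqrt (cabs2 z).

Definition inner_product {R : realType} (H : lmodType R[i]) (ip : H -> H -> R[i]) :=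
  [/\ forall (a : R[i]) (x y z : H), ip (a *: x + y) z = a * ip x z + ip y z,
      forall x y : H, ip y x = (ip x y)^*,
      forall x : H, 0 <= ip x x
    & forall x : H, ip x x = 0 -> x = 0].

Definition ipnorm {R : realType} (H : lmodType R[i]) (ip : H -> H -> R[i]) (x : H) : R :=
  Num.sqrt (cRe (ip x x)).

Definition ip_complete {R : realType} (H : lmodType R[i]) (ip : H -> H -> R[i]) :=
  forall u : nat -> H,
    (forall e : R, 0 < e -> exists N : nat, forall m n : nat,
        (N <= m)%N -> (N <= n)%N -> ipnorm ip (u m - u n) < e) ->
    exists l : H, forall e : R, 0 < e -> exists N : nat, forall n : nat,
        (N <= n)%N -> ipnorm ip (u n - l) < e.

Definition ip_separable {R : realType} (H : lmodType R[i]) (ip : H -> H -> R[i]) :=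
  exists d : nat -> H, forall (x : H) (e : R), 0 < e ->
    exists k : nat, ipnorm ip (x - d k) < e.

Definition hilbert_space {R : realType} (H : lmodType R[i]) (ip : H -> H -> R[i]) :=
  [/\ inner_product ip, ip_complete ip & ip_separable ip].

Definition leb2 {R : realType} :=
  ((@lebesgue_measure R) \x (@lebesgue_measure R))%E.

Definition weakly_measurable {R : realType} (H : lmodType R[i]) (ip : H -> H -> R[i])
  (psi : R * R -> H) :=
  forall f : H, measurable_fun setT (fun eta => cRe (ip f (psi eta))) /\
                measurable_fun setT (fun eta => cIm (ip f (psi eta))).

Definition continuous_parseval_frame {R : realType} (H : lmodType R[i])
  (ip : H -> H -> R[i]) (psi : R * R -> H) :=
  weakly_measurable ip psi /\
  forall f : H, ((ipnorm ip f) ^+ 2)%:E =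
                (\int[leb2]_eta (cabs2 (ip f (psi eta)))%:E)%E.

Definition discrete_frame {R : realType} (H : lmodType R[i]) (ip : H -> H -> R[i])
  (L : set (R * R)) (phi : R * R -> H) (A B : \bar R) :=
  forall f : H,
    (A * ((ipnorm ip f) ^+ 2)%:E <= \esum_(l in L) (cabs2 (ip f (phi l)))%:E)%E /\
    (\esum_(l in L) (cabs2 (ip f (phi l)))%:E <= B * ((ipnorm ip f) ^+ 2)%:E)%E.

Definition pd1 {R : realType} (g : R * R -> R) : R * R -> R :=
  fun p => derive1 (fun t => g (t, p.2)) p.1.
Definition pd2 {R : realType} (g : R * R -> R) : R * R -> R :=
  fun p => derive1 (fun t => g (p.1, t)) p.2.
Definition pd12 {R : realType} (g : R * R -> R) : R * R -> R := pd2 (pd1 g).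

Definition cont_mixed_partials {R : realType} (g : R * R -> R) :=
  (forall p : R * R, derivable (fun t => g (t, p.2)) p.1 1) /\
  (forall p : R * R, derivable (fun t => g (p.1, t)) p.2 1) /\
  (forall p : R * R, derivable (fun t => pd1 g (p.1, t)) p.2 1) /\
  continuous (pd1 g) /\ continuous (pd2 g) /\ continuous (pd12 g).

Definition ccont_mixed_partials {R : realType} (K : R * R -> R[i]) :=
  cont_mixed_partials (fun p => cRe (K p)) /\ cont_mixed_partials (fun p => cIm (K p)).

Definition cpd_abs {R : realType} (D : (R * R -> R) -> R * R -> R)
  (K : R * R -> R[i]) (p : R * R) : R :=
  Num.sqrt ((D (fun q => cRe (K q)) p) ^+ 2 + (D (fun q => cIm (K q)) p) ^+ 2).

Definition L1norm {R : realType} (h : R * R -> R) : \bar R :=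
  (\int[leb2]_p `|h p|%:E)%E.

Definition Rker {R : realType} (H : lmodType R[i]) (ip : H -> H -> R[i])
  (psi : R * R -> H) (nu eta : R * R) : R[i] := ip (psi eta) (psi nu).

Definition Kker {R : realType} (H : lmodType R[i]) (ip : H -> H -> R[i])
  (psi : R * R -> H) (eta nu : R * R) : R * R -> R[i] :=
  fun rho => Rker ip psi eta rho * Rker ip psi rho nu.

Definition Omega {R : realType} (H : lmodType R[i]) (ip : H -> H -> R[i])
  (psi : R * R -> H) : \bar R :=
  ess_sup leb2 (fun nu => \int[leb2]_eta
     (L1norm (cpd_abs pd1 (Kker ip psi eta nu)) +
      L1norm (cpd_abs pd2 (Kker ip psi eta nu)) +
      L1norm (cpd_abs pd12 (Kker ip psi eta nu)))%E)%E.

Definition shifted_box {R : realType} (rho eta : R * R) : set (R * R) :=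
  [set x | rho.1 <= x.1 <= rho.1 + eta.1 /\ rho.2 <= x.2 <= rho.2 + eta.2].

Definition unit_box {R : realType} (rho : R * R) : set (R * R) :=
  shifted_box rho (1, 1).

Definition count_pts {R : realType} (A : set (R * R)) : R := (#|` fset_set A|)%:R.

Definition Nrho {R : realType} (L : set (R * R)) (rho : R * R) : R :=
  count_pts (L `&` unit_box rho).

Definition aweight {R : realType} (L : set (R * R)) (l : R * R) : \bar R :=
  (\int[leb2]_rho (\1_(unit_box rho) l / Nrho L rho)%:E)%E.

Definition Dshift {R : realType} (L : set (R * R)) : \bar R :=
  ereal_sup [set (`| count_pts (L `&` shifted_box rho eta) / Nrho L rho
                    - eta.1 * eta.2 |)%:E
            | rho in setT & eta in [set e : R * R | 0 <= e.1 <= 1 /\ 0 <= e.2 <= 1]].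

(* Main.v *)
(** Write [c(eta, nu) = <f, psi_nu> * conj <f, psi_eta>]. Applying Parseval twice
    gives [|<f, psi_x>|^2 = \int\int Re (c(eta, nu) * K^(eta,nu)(x)) d eta d nu]
    for every [x]. For fixed [(eta, nu)] the difference between the average of the
    integrand over the points of [L] in the unit box at [rho] and its integral over
    that box is at most [Dshift L] times its variation on the box, anchored at the
    upper right corner (Koksma-Hlawka); integrating this in [rho], by translation
    invariance, yields [Dshift L * |c(eta, nu)|] times the sum of the three L1-norms
    in [Omega]. This sum is symmetric in [(eta, nu)], so Schur's test bounds the
    total error by [Dshift L * Omega * |f|^2]. Integrated over [rho], the averages
    become the frame sum and the box integrals become [|f|^2].

    Two points need care. [Omega] integrates functions whose measurability is not
    assumed, so that only comparisons of lower integrals are available. Nothing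
    bounds [|psi_x|] locally either: Fubini's theorem for the box integral is
    justified, for almost every [rho], by the same variation estimate applied to
    the oscillation of the integrand around its corner value. *)

Require Import Defs.
From HB Require Import structures.
From mathcomp Require Import all_boot all_order all_algebra.
From mathcomp Require Import all_classical all_reals all_analysis.
From mathcomp Require Import measurable_realfun ess_sup_inf finmap complex.
From mathcomp Require Import ring lra.
Set Implicit Arguments. Unset Strict Implicit. Unset Printing Implicit Defensive.
Import Order.TTheory GRing.Theory Num.Theory.
Import numFieldNormedType.Exports.
Local Open Scope classical_set_scope.
Local Open Scope ring_scope.

(** * Integration *)

(** The boxes counted by [Dshift] all start at the lower left corner [rho], and this dictates the
    corner of expansion. For x in the unit box at [rho], the condition x.1 <= t coming from the
    fundamental theorem of calculus says that x lies in the box from [rho] to (t, rho.2 + 1). A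
    function expanded at the upper right corner is thus a constant plus integrals of indicators of
    boxes starting at [rho]. Each indicator has sampling error at most [Dshift L], and a constant
    has none.

    Smoothness and [Omega] concern the kernels K, not f, so the error is estimated for each pair
    (eta, nu) and only then integrated over pairs. The kernels are smooth for almost every nu and
    then almost every eta; as the exceptional pairs need not form a measurable set, the two
    quantifiers stay nested up to Schur's test instead of becoming one for the product measure. *)

Section sigma_prod.
Context d1 d2 (T1 : measurableType d1) (T2 : measurableType d2) (R : realType).
Variable m1 : {sigma_finite_measure set T1 -> \bar R}.
Variable m2 : {sigma_finite_measure set T2 -> \bar R}.

(* An alias of [m1 \x m2] carrying its sigma-finite structure: on
   [product_measure1] itself canonical inference only finds the instance for
   products of subprobabilities. *)
Definition sigma_prod : set (T1 * T2) -> \bar R := (m1 \x m2)%E.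

HB.instance Definition _ := Measure.on sigma_prod.

Lemma sigma_finite_sigma_prod : sigma_finite setT sigma_prod.
Proof.
exact: (@isSigmaFinite.sigma_finiteT _ _ _ _
  (lebesgue_integral_fubini.measure_function_Measure_isSigmaFinite__to__measure_function_isSigmaFinite
     m1 m2)).
Qed.

HB.instance Definition _ :=
  Measure_isSigmaFinite.Build _ _ _ sigma_prod sigma_finite_sigma_prod.

End sigma_prod.

HB.instance Definition _ (R : realType) := Measure.on (@leb2 R).
HB.instance Definition _ (R : realType) :=
  Measure_isSigmaFinite.Build _ _ _ (@leb2 R)
    (@sigma_finite_sigma_prod _ _ _ _ R (@lebesgue_measure R) (@lebesgue_measure R)).

Section integral_monotone.
Local Open Scope ereal_scope.
Context d (T : measurableType d) (R : realType) (mu : {measure set T -> \bar R}).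

(* [g] need not be measurable: the integral of a nonnegative function is the
   supremum of the integrals of the simple functions below it. *)
Lemma ge0_le_integral_lower (f g : T -> \bar R) :
  (forall x, 0 <= f x) -> (forall x, f x <= g x) ->
  \int[mu]_x f x <= \int[mu]_x g x.
Proof.
move=> f0 fg.
have g0 x : 0 <= g x by exact: le_trans (f0 x) (fg x).
rewrite !ge0_integralTE//.
apply: ereal_sup_le => _ [h hf <-]; exists h => // x.
exact: le_trans (hf x) (fg x).
Qed.

(** Only [f] has to be measurable, because the null set is cut out of the integral of [f] alone; the
    restricted function lies below [g] everywhere. *)
Lemma ae_ge0_le_integral_lower (f g : T -> \bar R) :
  measurable_fun setT f -> (forall x, 0 <= f x) -> (forall x, 0 <= g x) ->
  (\forall x \ae mu, f x <= g x) -> \int[mu]_x f x <= \int[mu]_x g x.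
Proof.
move=> mf f0 g0 [N [mN N0 NP]].
rewrite (ge0_negligible_integral mN measurableT mf _ N0)//.
rewrite integral_mkcond; apply: ge0_le_integral_lower => x; rewrite patchE;
  case: ifPn => // /set_mem[_ Nx].
by apply: contrapT => xfg; exact/Nx/NP.
Qed.

End integral_monotone.

Section real_fubini.
Context d1 d2 (T1 : measurableType d1) (T2 : measurableType d2) (R : realType).
Variables (m1 : {sigma_finite_measure set T1 -> \bar R}).
Variables (m2 : {sigma_finite_measure set T2 -> \bar R}).

(** Partial integrals of an integrable function can be infinite on a null set, where [fine] returns
    0. This lets Fubini's theorem be stated with real-valued inner integrals. *)
Lemma fine_ae_integrable d (T : measurableType d) (m : {measure set T -> \bar R})
    (F : T -> \bar R) : m.-integrable setT F ->
  m.-integrable setT (EFin \o fine \o F) /\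
  (\int[m]_x (fine (F x))%:E = \int[m]_x F x)%E.
Proof.
move=> iF.
have mF := measurable_int _ iF.
have mfF : measurable_fun setT (EFin \o fine \o F).
  by apply/measurable_EFinP; exact: measurableT_comp.
have FE : ae_eq m setT F (EFin \o fine \o F).
  have := integrable_ae measurableT iF.
  by apply: filterS => x /(_ I) Fx _ /=; rewrite fineK.
split; last by apply: ae_eq_integral => //; exact: ae_eq_sym.
apply/integrableP; split => //.
case/integrableP : iF => _; rewrite (_ : \int[m]_x `|F x| =
   \int[m]_x `|(EFin \o fine \o F) x|)%E//.
apply: ae_eq_integral => //; [exact: measurableT_comp|exact: measurableT_comp|].
by move: FE; apply: filterS => x /[swap] _ /(_ I) ->.
Qed.

Lemma integrable_fubini_G (f : T1 * T2 -> \bar R) :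
  (m1 \x m2)%E.-integrable setT f -> m2.-integrable setT (fubini_G m1 f).
Proof.
move=> fi; have mf := measurable_int _ fi.
apply/integrableP; split; first exact: measurable_fubini_G fi.
apply: le_lt_trans ((integrable21ltyP m1 m2 mf).1 fi).
apply: ge0_le_integral => //.
- by apply: measurableT_comp => //; exact: measurable_fubini_G fi.
- apply: (@measurable_fun_fubini_tonelli_G _ _ _ _ _ m1 (fun z => `|f z|%E)) => //=.
  exact: measurableT_comp.
- move=> y _; apply: le_abse_integral => //.
  by apply: measurableT_comp => //; exact: measurable_pair2.
Qed.

Lemma Rintegral_fubini (f : T1 * T2 -> R) :
  (m1 \x m2)%E.-integrable setT (EFin \o f) ->
  [/\ m1.-integrable setT (EFin \o (fun x => \int[m2]_y f (x, y))),
      m2.-integrable setT (EFin \o (fun y => \int[m1]_x f (x, y))),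
      \int[(m1 \x m2)%E]_z f z = \int[m1]_x \int[m2]_y f (x, y) &
      \int[(m1 \x m2)%E]_z f z = \int[m2]_y \int[m1]_x f (x, y)].
Proof.
move=> fi.
have [i1 e1] := fine_ae_integrable (integrable_fubini_F fi).
have [i2 e2] := fine_ae_integrable (integrable_fubini_G fi).
split => //.
- by rewrite /Rintegral -(integral12_prod_meas1 fi) -e1.
- by rewrite /Rintegral -(integral21_prod_meas1 fi) -e2.
Qed.

End real_fubini.

Section measurable_integral.
Context d1 d2 (T1 : measurableType d1) (T2 : measurableType d2) (R : realType).
Variables (m2 : {sigma_finite_measure set T2 -> \bar R}).

(** Tonelli's theorem applies to the positive and the negative part, and the extended difference is
    measurable even where both are infinite. Box integrals of the kernel are measured this way
    before they are known to converge. *)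
Lemma measurable_integral2 (f : T1 * T2 -> \bar R) :
  measurable_fun setT f -> measurable_fun setT (fun x => \int[m2]_y f (x, y))%E.
Proof.
move=> mf.
rewrite [X in measurable_fun _ X](_ : _ = fubini_F m2 f^\+%E \- fubini_F m2 f^\-%E)%E.
  apply: emeasurable_funB; apply: measurable_fun_fubini_tonelli_F => //.
  - exact: measurable_funepos.
  - exact: measurable_funeneg.
apply: funext => x; rewrite [LHS]integralE /fubini_F /=.
by congr (_ - _)%E; apply: eq_integral => y _; [rewrite funepos_comp|rewrite funeneg_comp].
Qed.

Lemma measurable_Rintegral2 (f : T1 * T2 -> R) :
  measurable_fun setT f -> measurable_fun setT (fun x => \int[m2]_y f (x, y))%R.
Proof.
move=> mf; apply: measurableT_comp => //.
by apply: (measurable_integral2 (f := EFin \o f)); exact/measurable_EFinP.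
Qed.

End measurable_integral.

Lemma ge0_measurable_funV d (T : measurableType d) (R : realType) (f : T -> R) :
  measurable_fun setT f -> (forall x, 0 <= f x) ->
  measurable_fun setT (fun x => (f x)^-1).
Proof.
move=> mf f0; under eq_fun do rewrite -powR_inv1//.
by apply: (measurableT_comp (f := (@powR R) ^~ (-1)) (measurable_powR _)) mf.
Qed.

(** * Schur's test *)

Section schur.
Local Open Scope ereal_scope.
Context d (T : measurableType d) (R : realType).
Variable mu : {sigma_finite_measure set T -> \bar R}.

(** The nested quantifiers do not provide a null set of the product, since the set of bad pairs may
    be non-measurable. Comparing the iterated integrals one variable at a time avoids it. *)
Lemma ae_ge0_le_integral2 (f g : T * T -> \bar R) :
  measurable_fun setT f -> measurable_fun setT g ->
  (forall x, 0 <= f x) -> (forall x, 0 <= g x) ->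
  (\forall y \ae mu, \forall x \ae mu, f (x, y) <= g (x, y)) ->
  \int[mu \x mu]_z f z <= \int[mu \x mu]_z g z.
Proof.
move=> mf mg f0 g0 fg.
rewrite !fubini_tonelli2//.
apply: ae_ge0_le_integral => //.
- by move=> y _; exact: integral_ge0.
- exact: measurable_fun_fubini_tonelli_G.
- by move=> y _; exact: integral_ge0.
- exact: measurable_fun_fubini_tonelli_G.
apply: filterS fg => y fgy _; apply: ae_ge0_le_integral => //.
- by apply: measurableT_comp => //; exact: measurable_pair2.
- by apply: measurableT_comp => //; exact: measurable_pair2.
- by apply: filterS fgy => x + _.
Qed.

(* [W] may fail to be measurable: Tonelli's theorem is applied to the measurable
   function [Q = Phi / (p x * p y)], which [W] dominates. *)
Lemma schur_test (p : T -> R) (Phi : T * T -> \bar R) (W : T -> T -> \bar R)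
    (C : \bar R) :
  measurable_fun setT p -> (forall x, 0 <= p x)%R ->
  measurable_fun setT Phi -> (forall z, 0 <= Phi z) ->
  (forall x y, Phi (x, y) = Phi (y, x)) ->
  (forall x y, 0 <= W x y) ->
  (\forall y \ae mu, \forall x \ae mu, Phi (x, y) <= (p x * p y)%:E * W x y) ->
  (\forall y \ae mu, \int[mu]_x W x y <= C) ->
  \int[mu \x mu]_z Phi z <= C * \int[mu]_x (p x ^+ 2)%:E.
Proof.
move=> mp p0 mPhi Phi0 PhiC W0 PhiW WC.
pose q (x y : T) : R := (p x * p y)%R.
pose Q (z : T * T) := ((q z.1 z.2)^-1)%:E * Phi z.
have mp1 : measurable_fun setT (fun z : T * T => p z.1) by exact: measurableT_comp.
have mp2 : measurable_fun setT (fun z : T * T => p z.2) by exact: measurableT_comp.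
have q0 x y : (0 <= q x y)%R by exact: mulr_ge0.
have mQ : measurable_fun setT Q.
  apply: emeasurable_funM => //; apply/measurable_EFinP.
  by apply: ge0_measurable_funV => //; exact: (measurable_funM mp1 mp2).
have Q0 z : 0 <= Q z by rewrite mule_ge0 ?lee_fin ?invr_ge0.
have QC x y : Q (x, y) = Q (y, x) by rewrite /Q /q/= PhiC mulrC.
have mpp : measurable_fun setT (fun x => (p x ^+ 2)%:E).
  by apply/measurable_EFinP; exact: measurable_funX.
pose G y := \int[mu]_x Q (x, y).
have G0 y : 0 <= G y by exact: integral_ge0.
have mG : measurable_fun setT G by exact: measurable_fun_fubini_tonelli_G.
have GC : \forall y \ae mu, G y <= C.
  near=> y; apply: (@le_trans _ _ (\int[mu]_x W x y)); last by near: y.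
  apply: ae_ge0_le_integral_lower => //.
    by apply: measurableT_comp => //; exact: measurable_pair2.
  have : \forall x \ae mu, Phi (x, y) <= (p x * p y)%:E * W x y by near: y.
  apply: filterS => x PW; rewrite /Q /=.
  (* Where [q] vanishes, so does [Q], as the inverse of 0 is 0. *)
  have [qe|qn] := eqVneq (q x y) 0%R; first by rewrite qe invr0 mul0e.
  apply: (@le_trans _ _ (((q x y)^-1)%:E * ((q x y)%:E * W x y))).
    by rewrite lee_wpmul2l ?lee_fin ?invr_ge0.
  by rewrite muleA -EFinM mulVf// mul1e.
have int1 : \int[mu \x mu]_z ((p z.2 ^+ 2)%:E * Q z) = \int[mu]_y ((p y ^+ 2)%:E * G y).
  rewrite fubini_tonelli2//=; last first.
  - by move=> z; rewrite mule_ge0 ?lee_fin ?sqr_ge0.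
  - by apply: emeasurable_funM => //; exact: (measurableT_comp mpp).
  apply: eq_integral => y _; rewrite /fubini_G /=.
  rewrite ge0_integralZl ?lee_fin ?sqr_ge0//.
  by apply: measurableT_comp => //; exact: measurable_pair2.
have int2 : \int[mu \x mu]_z ((p z.1 ^+ 2)%:E * Q z) = \int[mu]_y ((p y ^+ 2)%:E * G y).
  rewrite fubini_tonelli1//=; last first.
  - by move=> z; rewrite mule_ge0 ?lee_fin ?sqr_ge0.
  - by apply: emeasurable_funM => //; exact: (measurableT_comp mpp).
  apply: eq_integral => y _; rewrite /fubini_F /=.
  rewrite ge0_integralZl ?lee_fin ?sqr_ge0//.
    by congr (_ * _); apply: eq_integral => x _.
  by apply: measurableT_comp => //; exact: measurable_pair1.
have le3 : \int[mu]_y ((p y ^+ 2)%:E * G y) <= C * \int[mu]_x (p x ^+ 2)%:E.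
  have [C0|C0] := leP 0 C.
    rewrite -ge0_integralZl//; last by move=> x _; rewrite lee_fin sqr_ge0.
    apply: ae_ge0_le_integral => //.
    - by move=> x _; rewrite mule_ge0 ?lee_fin ?sqr_ge0.
    - exact: emeasurable_funM.
    - by move=> x _; rewrite mule_ge0 ?lee_fin ?sqr_ge0.
    - by apply: emeasurable_funM => //; exact: measurable_cst.
    - by apply: filterS GC => x GCx _; rewrite muleC lee_wpmul2r ?lee_fin ?sqr_ge0.
  (* For C < 0 the bound 0 <= G y <= C holds nowhere, yet almost everywhere: the measure is zero and
     any two functions agree almost everywhere. *)
  have ae0 (h : T -> \bar R) : ae_eq mu setT h (cst 0).
    apply: filterS GC => y GCy.
    by have := lt_le_trans (le_lt_trans GCy C0) (G0 y); rewrite ltxx.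
  rewrite (@ae_eq_integral _ _ _ mu setT (cst 0))//; last exact: emeasurable_funM.
  by rewrite (@ae_eq_integral _ _ _ mu setT (cst 0) (fun x => (p x ^+ 2)%:E))// integral0 mule0.
(* Uses p x * p y <= (p x ^+ 2 + p y ^+ 2) / 2. The two halves have equal integrals because [Q]
   inherits the symmetry of [Phi]; none is asked of [W]. *)
apply: (@le_trans _ _ (\int[mu \x mu]_z
   ((2^-1)%:E * ((p z.1 ^+ 2)%:E * Q z + (p z.2 ^+ 2)%:E * Q z)))).
  apply: ae_ge0_le_integral2 => //.
  - apply: emeasurable_funM => //; apply: emeasurable_funD.
    + by apply: emeasurable_funM => //; exact: (measurableT_comp mpp).
    + by apply: emeasurable_funM => //; exact: (measurableT_comp mpp).
  - by move=> z; rewrite mule_ge0 ?lee_fin// adde_ge0// mule_ge0 ?lee_fin ?sqr_ge0.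
  apply: filterS PhiW => y; apply: filterS => x PW.
  rewrite -ge0_muleDl ?lee_fin ?sqr_ge0// muleA -EFinD -EFinM.
  apply: (@le_trans _ _ ((q x y)%:E * Q (x, y))); last first.
    rewrite lee_wpmul2r// lee_fin /q /=.
    rewrite -ler_pdivrMl ?invr_gt0// invrK -subr_ge0.
    by have := sqr_ge0 (p x - p y)%R; rewrite sqrrB; nra.
  rewrite /Q/= muleA -EFinM.
  have [qe|qn] := eqVneq (q x y) 0%R; last by rewrite mulfV// mul1e.
  by move: PW; rewrite -/(q x y) qe !mul0r !mul0e.
rewrite ge0_integralZl//; last 2 first.
- apply: emeasurable_funD.
  + by apply: emeasurable_funM => //; exact: (measurableT_comp mpp).
  + by apply: emeasurable_funM => //; exact: (measurableT_comp mpp).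
- by move=> z _; rewrite adde_ge0// mule_ge0 ?lee_fin ?sqr_ge0.
rewrite ge0_integralD//; last 4 first.
- by move=> z _; rewrite mule_ge0 ?lee_fin ?sqr_ge0.
- by apply: emeasurable_funM => //; exact: (measurableT_comp mpp).
- by move=> z _; rewrite mule_ge0 ?lee_fin ?sqr_ge0.
- by apply: emeasurable_funM => //; exact: (measurableT_comp mpp).
rewrite int1 int2.
set I := (X in X + X).
have -> : I + I = 2%:E * I.
  have -> : 2%:E = 1 + 1 :> \bar R by rewrite -EFinD.
  by rewrite ge0_muleDl// mul1e.
by rewrite muleA -EFinM mulVf// mul1e.
Unshelve. all: by end_near. Qed.

End schur.

(** * Lebesgue measure on the line and the plane *)

Section lebesgue_plane.
Context {R : realType}.
Local Notation leb := (@lebesgue_measure R).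
Implicit Types (f : R -> \bar R) (g : R * R -> R).

(** The image of Lebesgue measure under a translation has the same values on half-open intervals,
    hence equals it by uniqueness. *)
Lemma ge0_integral_shift (c : R) f : measurable_fun setT f ->
  (forall x, (0 <= f x)%E) ->
  (\int[leb]_x f (x + c)%R = \int[leb]_x f x)%E.
Proof.
move=> mf f0.
have mc : measurable_fun setT ((fun x => x + c) : measurableTypeR R -> measurableTypeR R).
  exact: measurable_funD.
have <- : (\int[pushforward leb (fun x => (x + c)%R : measurableTypeR R)]_x f x =
    \int[leb]_x f (x + c)%R)%E.
  by rewrite (ge0_integral_pushforward mc).
apply: eq_measure_integral => A mA _.
apply/esym/lebesgue_measure_unique => //= _ [[a b]] _ <-.
rewrite /pushforward.
rewrite (_ : _ @^-1` _ = `]a - c, b - c]%classic); last first.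
  by apply/seteqP; split => x /=; rewrite !in_itv/= ltrBlDr lerBrDr.
rewrite /= !lebesgue_measure_itv/= !lte_fin ltrD2r -!EFinD.
by case: ifP => // _; congr EFin; ring.
Qed.

(** Measurability refers to the product sigma-algebra, so [U] is written as the countable union of
    the rational open rectangles it contains. *)
Lemma open_measurable2 (U : set (R * R)) : open U -> measurable U.
Proof.
move=> oU.
pose box (q : (rat * rat) * (rat * rat)) : set (R * R) :=
  `]ratr q.1.1, ratr q.1.2[ `*` `]ratr q.2.1, ratr q.2.2[.
pose F q := if `[< box q `<=` U >] then box q else set0.
suff -> : U = \bigcup_q F q.
  apply: countable_bigcupT_measurable => // q; rewrite /F.
  by case: ifP => // _; exact: measurableX.
apply/seteqP; split => [[x y] Uxy|x [q _]]; last first.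
  by rewrite /F; case: asboolP => // + xq; exact.
have /nbhs_ballP[e /= e0 eU] := open_nbhs_nbhs (conj oU Uxy).
have rat_nbhd (z : R) : exists p : rat * rat,
    z - e < ratr p.1 < z /\ z < ratr p.2 < z + e.
  have ze : z - e < z by rewrite ltrBlDr ltrDl.
  have ez : z < z + e by rewrite ltrDl.
  have [a ha] := rat_in_itvoo ze; have [b hb] := rat_in_itvoo ez.
  by exists (a, b); rewrite !in_itv/= in ha hb.
have [p [/andP[p1 p2] /andP[p3 p4]]] := rat_nbhd x.
have [q [/andP[q1 q2] /andP[q3 q4]]] := rat_nbhd y.
exists (p, q) => //; rewrite /F; case: asboolP => [_|].
  by rewrite /box /= !in_itv/= p2 p3 q2 q3.
case=> -[u v] [] /=; rewrite !in_itv/= => /andP[u1 u2] /andP[v1 v2].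
apply: eU; split; rewrite /ball/= distrC ltr_distl.
  by rewrite (lt_trans p1 u1) (lt_trans u2 p4).
by rewrite (lt_trans q1 v1) (lt_trans v2 q4).
Qed.

Lemma continuous_measurable_fun2 g : continuous g -> measurable_fun setT g.
Proof.
move=> /continuousP cg; apply: (measurability _ (RGenOpens.measurableE R)).
move=> _ [_ [a [b ->] <-]]; rewrite setTI; apply: open_measurable2.
exact/cg/interval_open.
Qed.

Lemma leb2_rectangle (A B : set R) : measurable A -> measurable B ->
  (leb2 (A `*` B) = leb A * leb B)%E.
Proof. by move=> mA mB; exact: (product_measure1E leb leb mA mB). Qed.

Lemma continuous_integrable_rectangle g (a b c d : R) : continuous g ->
  leb2.-integrable setT (EFin \o (fun y => \1_(`[a, b] `*` `[c, d]) y * g y)).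
Proof.
move=> cg; set B := _ `*` _.
have mB : measurable B by exact: measurableX.
have -> : (fun y => \1_B y * g y) = g \_ B.
  by apply/funext => y; rewrite patchE indicE; case: ifP; rewrite ?mul1r ?mul0r.
rewrite -restrict_EFin; apply/integrable_restrict => //; rewrite setTI.
apply: measurable_bounded_integrable => //.
- by rewrite [X in (X < _)%E]leb2_rectangle// lte_mul_pinfty// ?lebesgue_measure_itv//=;
    case: ifP => // _; rewrite -EFinB ltry.
- by apply: measurable_funTS; exact: continuous_measurable_fun2.
- have cB : compact B by apply: compact_setX; exact: segment_compact.
  have /compact_bounded[M [Mr HM]] : compact (g @` B).
    by apply: continuous_compact => //; exact: continuous_subspaceT.
  exists M; split => // M' /HM h y By; apply: h; by exists y.
Qed.

Lemma continuous_integrable_segment (f : R -> R) (a b : R) : continuous f ->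
  leb.-integrable setT (EFin \o (fun y => \1_`[a, b] y * f y)).
Proof.
move=> cf.
have -> : (fun y => \1_`[a, b] y * f y) = f \_ `[a, b].
  by apply/funext => y; rewrite patchE indicE; case: ifP; rewrite ?mul1r ?mul0r.
rewrite -restrict_EFin; apply/integrable_restrict => //; rewrite setTI.
apply: continuous_compact_integrable; first exact: segment_compact.
exact: continuous_subspaceT.
Qed.

Lemma FTC_segment (F : R -> R) (a b : R) : a <= b ->
  (forall x, derivable F x 1) -> continuous (derive1 F) ->
  \int[leb]_t (\1_`[a, b] t * derive1 F t) = F b - F a.
Proof.
move=> ab dF cF.
have -> : (fun y => \1_`[a, b] y * derive1 F y) = derive1 F \_ `[a, b].
  by apply/funext => y; rewrite patchE indicE; case: ifP; rewrite ?mul1r ?mul0r.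
rewrite -Rintegral_mkcond.
move: ab; rewrite le_eqVlt => /predU1P[->|ab].
  by rewrite set_itv1 Rintegral_set1 subrr.
have contF : continuous F.
  by move=> x; apply: differentiable_continuous; exact/derivable1_diffP.
rewrite /Rintegral (continuous_FTC2 ab (F := F))//.
- exact: continuous_subspaceT.
- split => //.
  + by apply: cvg_at_right_filter; exact: contF.
  + by apply: cvg_at_left_filter; exact: contF.
Qed.

End lebesgue_plane.

Lemma measurable_set_le d (T : measurableType d) (R : realType) (f g : T -> R) :
  measurable_fun setT f -> measurable_fun setT g ->
  measurable [set z | f z <= g z].
Proof.
move=> mf mg.
have -> : [set z | f z <= g z] = setT `&` (g \- f) @^-1` `[0, +oo[.
  by apply/seteqP; split => z /=; rewrite in_itv/= andbT subr_ge0//; case.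
exact: measurable_funB.
Qed.

Section Rintegral_sum.
Context d (T : measurableType d) (R : realType) (mu : {measure set T -> \bar R}).

Lemma Rintegral_sum (I : Type) (s : seq I) (w : R) (f : I -> T -> R) :
  (forall i, mu.-integrable setT (EFin \o f i)) ->
  mu.-integrable setT (EFin \o (fun x => \sum_(i <- s) w * f i x)) /\
  \sum_(i <- s) w * \int[mu]_x f i x = \int[mu]_x \sum_(i <- s) w * f i x.
Proof.
move=> fi; elim: s => [|i s [IHi IHe]].
  split; last first.
    rewrite big_nil; under eq_Rintegral do rewrite big_nil.
    by rewrite Rintegral_cst//= mul0r.
  rewrite [X in integrable _ _ X](_ : _ = cst 0%E); first exact: integrable0.
  by apply/funext => x /=; rewrite big_nil.
have wfi : mu.-integrable setT (EFin \o (fun x => w * f i x)).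
  exact: (integrableZl measurableT w (fi i)).
have -> : (fun x => \sum_(i <- i :: s) w * f i x) =
    (fun x => w * f i x) \+ (fun x => \sum_(i <- s) w * f i x).
  by apply/funext => x /=; rewrite big_cons.
split; first exact: (integrableD measurableT wfi IHi).
by rewrite big_cons IHe RintegralD// RintegralZl.
Qed.

End Rintegral_sum.

(** * The Koksma-Hlawka inequality on unit boxes *)

Section boxes.
Context {R : realType}.
Implicit Types rho e x : R * R.

Lemma shifted_boxE rho e : shifted_box rho e =
  `[rho.1, rho.1 + e.1] `*` `[rho.2, rho.2 + e.2].
Proof. by apply/seteqP; split => x /=; rewrite !in_itv. Qed.

Lemma measurable_shifted_box rho e : measurable (shifted_box rho e).
Proof. by rewrite shifted_boxE; exact: measurableX. Qed.

Lemma leb2_shifted_box rho e : 0 <= e.1 -> 0 <= e.2 ->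
  leb2 (shifted_box rho e) = (e.1 * e.2)%:E.
Proof.
move=> e1 e2; rewrite shifted_boxE leb2_rectangle// !lebesgue_measure_itv/=.
rewrite !lte_fin !ltrDl -!EFinB !(addrAC _ _ (- _)) !subrr !add0r.
case: ltP => h1; last by rewrite (le_anti (introT andP (conj h1 e1))) mul0e mul0r.
case: ltP => h2; last by rewrite (le_anti (introT andP (conj h2 e2))) mule0 mulr0.
by rewrite EFinM.
Qed.

Lemma integrable_indic_box rho e : 0 <= e.1 -> 0 <= e.2 ->
  leb2.-integrable setT (EFin \o (\1_(shifted_box rho e) : R * R -> R)) /\
  \int[leb2]_x (\1_(shifted_box rho e) x : R) = e.1 * e.2.
Proof.
move=> e1 e2.
have intE : (\int[leb2]_x (\1_(shifted_box rho e) x)%:E = (e.1 * e.2)%:E)%E.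
  rewrite integral_indic//; last exact: measurable_shifted_box.
  by rewrite setIT; exact: leb2_shifted_box.
split; last by rewrite /Rintegral intE.
apply/integrableP; split.
  by apply/measurable_EFinP; apply: measurable_indic; exact: measurable_shifted_box.
rewrite (_ : integral _ _ _ = (e.1 * e.2)%:E) ?ltry// -intE.
by apply: eq_integral => x _ /=; rewrite ger0_norm.
Qed.

Lemma subset_shifted_box rho e : e.1 <= 1 -> e.2 <= 1 ->
  shifted_box rho e `<=` unit_box rho.
Proof.
move=> e1 e2 x [/andP[x1 x2] /andP[x3 x4]]; split => /=; apply/andP; split => //.
- by rewrite (le_trans x2)// lerD2l.
- by rewrite (le_trans x4)// lerD2l.
Qed.

Lemma measurable_indic_box d (Y : measurableType d) (r e x : Y -> R * R) :
  measurable_fun setT (fun y => (r y).1) -> measurable_fun setT (fun y => (r y).2) ->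
  measurable_fun setT (fun y => (e y).1) -> measurable_fun setT (fun y => (e y).2) ->
  measurable_fun setT (fun y => (x y).1) -> measurable_fun setT (fun y => (x y).2) ->
  measurable_fun setT (fun y => \1_(shifted_box (r y) (e y)) (x y) : R).
Proof.
move=> r1 r2 e1 e2 x1 x2.
pose A := [set y | (r y).1 <= (x y).1] `&` [set y | (x y).1 <= (r y).1 + (e y).1]
  `&` ([set y | (r y).2 <= (x y).2] `&` [set y | (x y).2 <= (r y).2 + (e y).2]).
rewrite (_ : (fun y => _) = \1_A); last first.
  apply/funext => y; rewrite !indicE; congr (_%:R); congr nat_of_bool.
  apply/idP/idP => /set_mem H; apply/mem_set; move: H.
    by case=> /andP[? ?] /andP[? ?].
  by case=> -[/= ? ?] [/= ? ?]; split; apply/andP.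
apply: measurable_indic; apply: measurableI; apply: measurableI;
  apply: measurable_set_le => //; exact: measurable_funD.
Qed.

End boxes.

Section discrepancy.
Context {R : realType}.
Implicit Types (rho : R * R) (l : seq (R * R)).

(** A bound on the star discrepancy of the points of [l], each of mass [w], relative to the unit box
    at [rho]. *)
Definition discrepancy_le rho l (w D : R) :=
  forall e : R * R, 0 <= e.1 <= 1 -> 0 <= e.2 <= 1 ->
  `| \sum_(x <- l) w * \1_(shifted_box rho e) x - e.1 * e.2 | <= D.

Definition quad_error rho l (w : R) (h : R * R -> R) : R :=
  \sum_(x <- l) w * h x - \int[leb2]_x (\1_(unit_box rho) x * h x).

(** The quadrature error is linear and at most [D] on the indicator of a box starting at [rho]. By
    Fubini's theorem the error of a superposition with density [u] is at most [D] times the mass of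
    [u]. Leaving [kappa] general covers both the edge terms on the line and the interior term on the
    plane. *)
Lemma quad_error_superposition d (Y : measurableType d)
    (kappa : {sigma_finite_measure set Y -> \bar R})
    rho l (w D : R) (u : Y -> R) (e : Y -> R * R) :
  discrepancy_le rho l w D ->
  measurable_fun setT (fun y => (e y).1) -> measurable_fun setT (fun y => (e y).2) ->
  (forall y, u y != 0 -> 0 <= (e y).1 <= 1 /\ 0 <= (e y).2 <= 1) ->
  kappa.-integrable setT (EFin \o u) ->
  let h x := \int[kappa]_y (\1_(shifted_box rho (e y)) x * u y) in
  [/\ leb2.-integrable setT (EFin \o (fun x => \1_(unit_box rho) x * h x)),
      forall x, `|h x| <= \int[kappa]_y `|u y| &
      `| quad_error rho l w h | <= D * \int[kappa]_y `|u y| ].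
Proof.
move=> disc me1 me2 he ui h.
have mu : measurable_fun setT u by apply/measurable_EFinP; exact: measurable_int ui.
have aui : kappa.-integrable setT (EFin \o (fun y => `|u y|)) by exact: integrable_abse ui.
have sec_i x : kappa.-integrable setT (EFin \o (fun y => \1_(shifted_box rho (e y)) x * u y)).
  apply: le_integrable ui => //.
    apply/measurable_EFinP; apply: measurable_funM => //.
    exact: measurable_indic_box.
  move=> y _ /=; rewrite lee_fin normrM ler_piMl// indicE.
  by case: (_ \in _); rewrite ?normr1 ?normr0.
have hle x : `|h x| <= \int[kappa]_y `|u y|.
  apply: (le_trans (le_normr_Rintegral measurableT (sec_i x))).
  apply: le_Rintegral => //.
    exact: (integrable_abse (sec_i x)).
  move=> y _; rewrite normrM ler_piMl// indicE.
  by case: (_ \in _); rewrite ?normr1 ?normr0.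
pose f (z : Y * (R * R)) := \1_(unit_box rho) z.2 * \1_(shifted_box rho (e z.1)) z.2 * u z.1.
have mf : measurable_fun setT f.
  apply: measurable_funM.
    apply: measurable_funM.
      apply: measurableT_comp => //; apply: measurable_indic.
      exact: measurable_shifted_box.
    apply: measurable_indic_box => //.
    - exact: (measurableT_comp me1).
    - exact: (measurableT_comp me2).
    - by apply: measurableT_comp => //.
    - by apply: measurableT_comp => //.
  exact: (measurableT_comp mu).
have fi : (kappa \x leb2)%E.-integrable setT (EFin \o f).
  apply/(integrable12ltyP kappa leb2); first exact/measurable_EFinP.
  case/integrableP : ui => _; apply: le_lt_trans.
  apply: ge0_le_integral => //=.
  - by move=> y _; exact: integral_ge0.
  - apply: (measurable_integral2 leb2 (f := fun z => `|f z|%:E)).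
    by apply/measurable_EFinP; exact: measurableT_comp.
  - by apply/measurable_EFinP; exact: measurableT_comp.
  move=> y _.
  apply: (@le_trans _ _ (\int[leb2]_x (`|u y|%:E * (\1_(unit_box rho) x)%:E))%E).
    apply: ge0_le_integral => //.
    - apply/measurable_EFinP; apply: measurableT_comp => //.
      by apply: measurableT_comp => //; exact: measurable_pair1.
    - apply: emeasurable_funM => //; apply/measurable_EFinP.
      by apply: measurable_indic; exact: measurable_shifted_box.
    - move=> x _; rewrite -EFinM lee_fin !normrM mulrC ler_wpM2l// !indicE.
      by do 2 case: (_ \in _); rewrite ?normr1 ?normr0 ?mul1r ?mul0r.
  rewrite ge0_integralZl//; last first.
    apply/measurable_EFinP; apply: measurable_indic.
    exact: measurable_shifted_box.
  rewrite integral_indic//; last exact: measurable_shifted_box.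
  by rewrite setIT [X in (_ * X)%E]leb2_shifted_box//= !mulr1 mule1.
have [i1 i2 fe1 fe2] := Rintegral_fubini fi.
have fhE x : \int[kappa]_y f (y, x) = \1_(unit_box rho) x * h x.
  rewrite -RintegralZl//.
  by apply: eq_Rintegral => y _; rewrite /f /= mulrA.
have i2' : leb2.-integrable setT (EFin \o (fun x => \1_(unit_box rho) x * h x)).
  by apply: eq_integrable i2 => // x _ /=; rewrite fhE.
split => //.
have [si1 si2] := Rintegral_sum l w sec_i.
rewrite /quad_error si2.
have -> : \int[leb2]_x (\1_(unit_box rho) x * h x) = \int[kappa]_y \int[leb2]_x f (y, x).
  by rewrite -fe1 fe2; apply: eq_Rintegral => x _; rewrite fhE.
rewrite -RintegralB//.
(* Where [u y] is 0 both sides vanish. Elsewhere the small box lies in the unit box, so the product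
   of the indicators is that of the small box, whose integral is its area. *)
have diE y : \sum_(x <- l) w * (\1_(shifted_box rho (e y)) x * u y) - \int[leb2]_x f (y, x)
    = u y * (\sum_(x <- l) w * \1_(shifted_box rho (e y)) x - (e y).1 * (e y).2).
  under eq_bigr do rewrite mulrA.
  rewrite -mulr_suml mulrBr [_ * u y]mulrC; congr (_ - _).
  have [u0|/he [/andP[a0 a1] /andP[b0 b1]]] := eqVneq (u y) 0.
    rewrite u0 mul0r /Rintegral integral0_eq// => x _.
    by rewrite /f /= u0 mulr0.
  transitivity (\int[leb2]_x (u y * \1_(shifted_box rho (e y)) x)).
    apply: eq_Rintegral => x _; rewrite /f /= mulrC; congr (_ * _).
    rewrite !indicE; case: (boolP (x \in shifted_box rho (e y))) => [xs|_].
      by rewrite mem_set ?mul1r//; exact: subset_shifted_box (set_mem xs).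
    by rewrite mulr0.
  have [bi be] := integrable_indic_box rho a0 b0.
  by rewrite RintegralZl// be.
have di : kappa.-integrable setT (EFin \o (fun y =>
   \sum_(x <- l) w * (\1_(shifted_box rho (e y)) x * u y) - \int[leb2]_x f (y, x))).
  exact: (integrableB measurableT si1 i1).
apply: (le_trans (le_normr_Rintegral measurableT di)).
rewrite -RintegralZl//; apply: le_Rintegral => //.
- exact: integrable_abse di.
- exact: (integrableZl measurableT D aui).
move=> y _; rewrite diE normrM mulrC.
have [->|/he [ha hb]] := eqVneq (u y) 0; first by rewrite normr0 !mulr0.
by rewrite ler_wpM2r// disc.
Qed.

End discrepancy.

Section koksma.
Context {R : realType}.
Local Notation leb := (@lebesgue_measure R).
Implicit Types (rho x : R * R) (l : seq (R * R)) (g : R * R -> R).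

Lemma EFin_Rintegral d (T : measurableType d) (mu : {measure set T -> \bar R})
    (f : T -> R) : mu.-integrable setT (EFin \o f) ->
  (\int[mu]_x f x)%:E = (\int[mu]_x (f x)%:E)%E.
Proof. by move=> fi; rewrite fineK//; exact: integrable_fin_num. Qed.

Lemma continuous_slice1 g (s : R) : continuous g -> continuous (fun t => g (t, s)).
Proof.
move=> cg t; apply: (continuous_comp (f := fun t => (t, s))); last exact: cg.
by apply: (@cvg_pair _ _ _ _ (nbhs t) (nbhs s)); [exact: cvg_id|exact: cvg_cst].
Qed.

Lemma continuous_slice2 g (t : R) : continuous g -> continuous (fun s => g (t, s)).
Proof.
move=> cg s; apply: (continuous_comp (f := fun s => (t, s))); last exact: cg.
by apply: (@cvg_pair _ _ _ _ (nbhs t) (nbhs s)); [exact: cvg_cst|exact: cvg_id].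
Qed.

Lemma indic_rectangle (A B : set R) (p : R * R) :
  \1_(A `*` B) p = \1_A p.1 * \1_B p.2 :> R.
Proof. by rewrite !indicE in_setX; do 2 case: (_ \in _); rewrite ?mulr1 ?mulr0. Qed.

Lemma Rintegral_pd1 g (a b s : R) : cont_mixed_partials g -> a <= b ->
  \int[leb]_t (\1_`[a, b] t * pd1 g (t, s)) = g (b, s) - g (a, s).
Proof.
move=> [d1 [_ [_ [c1 _]]]] ab.
apply: (@FTC_segment R (fun t => g (t, s)) a b ab) => [t|]; first exact: (d1 (t, s)).
exact (continuous_slice1 c1).
Qed.

Lemma Rintegral_pd2 g (a b t : R) : cont_mixed_partials g -> a <= b ->
  \int[leb]_s (\1_`[a, b] s * pd2 g (t, s)) = g (t, b) - g (t, a).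
Proof.
move=> [_ [d2 [_ [_ [c2 _]]]]] ab.
apply: (@FTC_segment R (fun s => g (t, s)) a b ab) => [s|]; first exact: (d2 (t, s)).
exact (continuous_slice2 c2).
Qed.

(** Since [pd12] is [pd2] of [pd1], the second variable is integrated first; this leaves a
    difference of [pd1 g] on two horizontal lines. *)
Lemma Rintegral_pd12 g (a1 b1 a2 b2 : R) : cont_mixed_partials g ->
  a1 <= b1 -> a2 <= b2 ->
  \int[leb2]_y (\1_(`[a1, b1] `*` `[a2, b2]) y * pd12 g y) =
  g (b1, b2) - g (a1, b2) - (g (b1, a2) - g (a1, a2)).
Proof.
move=> mg ab1 ab2; have [d1 [_ [d12 [c1 [_ c12]]]]] := mg.
have fi := continuous_integrable_rectangle a1 b1 a2 b2 c12.
have [_ _ + _] := @Rintegral_fubini _ _ _ _ _ leb leb _ fi.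
move=> ->.
rewrite -!Rintegral_pd1// -RintegralB//; last 2 first.
- exact: continuous_integrable_segment (continuous_slice1 c1).
- exact: continuous_integrable_segment (continuous_slice1 c1).
apply: eq_Rintegral => t _; rewrite -mulrBr.
have <- : \int[leb]_s (\1_`[a2, b2] s * pd12 g (t, s)) = pd1 g (t, b2) - pd1 g (t, a2).
  apply: (@FTC_segment R (fun s => pd1 g (t, s)) a2 b2 ab2) => [s|].
    exact: (d12 (t, s)).
  exact (continuous_slice2 c12).
transitivity (\int[leb]_s (\1_`[a1, b1] t * (\1_`[a2, b2] s * pd12 g (t, s)))).
  by apply: eq_Rintegral => s _; rewrite indic_rectangle mulrA.
have si : leb.-integrable setT (EFin \o (fun s => \1_`[a2, b2] s * pd12 g (t, s))).
  exact: continuous_integrable_segment (continuous_slice2 c12).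
exact: (@RintegralZl _ _ _ leb _ _ _ measurableT si).
Qed.

(** With the partial derivatives of a function as arguments, this is its Hardy-Krause variation on
    the unit box: contributions of the top edge, the right edge and the interior. *)
Definition box_variation (h1 h2 h12 : R * R -> R) rho : \bar R :=
  (\int[leb]_t (\1_`[rho.1, rho.1 + 1] t * `|h1 (t, rho.2 + 1)|)%:E +
   \int[leb]_s (\1_`[rho.2, rho.2 + 1] s * `|h2 (rho.1 + 1, s)|)%:E +
   \int[leb2]_y (\1_(unit_box rho) y * `|h12 y|)%:E)%E.

(** For x in the box, the product of the two indicators in each integral is the indicator of the
    segment or rectangle from x to the top, the right edge or the corner. The three integrals are
    then differences of values of [g], which telescope to [g x]. *)
Lemma box_expansion g rho x : cont_mixed_partials g -> unit_box rho x ->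
  g x = g (rho.1 + 1, rho.2 + 1)
   - \int[leb]_t (\1_(shifted_box rho (t - rho.1, 1)) x *
       (\1_`[rho.1, rho.1 + 1] t * pd1 g (t, rho.2 + 1)))
   - \int[leb]_s (\1_(shifted_box rho (1, s - rho.2)) x *
       (\1_`[rho.2, rho.2 + 1] s * pd2 g (rho.1 + 1, s)))
   + \int[leb2]_y (\1_(shifted_box rho (y.1 - rho.1, y.2 - rho.2)) x *
       (\1_(unit_box rho) y * pd12 g y)).
Proof.
move=> mg; case: x => x1 x2 [/= /andP[x11 x12] /andP[x21 x22]].
have -> : \int[leb]_t (\1_(shifted_box rho (t - rho.1, 1)) (x1, x2) *
       (\1_`[rho.1, rho.1 + 1] t * pd1 g (t, rho.2 + 1))) =
   g (rho.1 + 1, rho.2 + 1) - g (x1, rho.2 + 1).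
  rewrite -Rintegral_pd1//; apply: eq_Rintegral => t _.
  rewrite mulrA; congr (_ * _); rewrite !indicE -natrM mulnb; congr (_%:R).
  congr nat_of_bool; apply/andP/idP.
    case=> /set_mem[/= /andP[h1 h2] /andP[h3 h4]] /set_mem/=; rewrite !in_itv/= => h5.
    by apply/mem_set; rewrite /= in_itv/=; lra.
  move=> /set_mem/=; rewrite in_itv/= => h; split; apply/mem_set.
    by split; rewrite /=; lra.
  by rewrite /= in_itv/=; lra.
have -> : \int[leb]_s (\1_(shifted_box rho (1, s - rho.2)) (x1, x2) *
       (\1_`[rho.2, rho.2 + 1] s * pd2 g (rho.1 + 1, s))) =
   g (rho.1 + 1, rho.2 + 1) - g (rho.1 + 1, x2).
  rewrite -Rintegral_pd2//; apply: eq_Rintegral => t _.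
  rewrite mulrA; congr (_ * _); rewrite !indicE -natrM mulnb; congr (_%:R).
  congr nat_of_bool; apply/andP/idP.
    case=> /set_mem[/= /andP[h1 h2] /andP[h3 h4]] /set_mem/=; rewrite !in_itv/= => h5.
    by apply/mem_set; rewrite /= in_itv/=; lra.
  move=> /set_mem/=; rewrite in_itv/= => h; split; apply/mem_set.
    by split; rewrite /=; lra.
  by rewrite /= in_itv/=; lra.
have -> : \int[leb2]_y (\1_(shifted_box rho (y.1 - rho.1, y.2 - rho.2)) (x1, x2) *
       (\1_(unit_box rho) y * pd12 g y)) =
   g (rho.1 + 1, rho.2 + 1) - g (x1, rho.2 + 1) - (g (rho.1 + 1, x2) - g (x1, x2)).
  rewrite -Rintegral_pd12//; apply: eq_Rintegral => -[t s] _.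
  rewrite mulrA; congr (_ * _); rewrite !indicE -natrM mulnb; congr (_%:R).
  congr nat_of_bool; apply/andP/idP.
    case=> /set_mem[/= /andP[h1 h2] /andP[h3 h4]] /set_mem[/= h5 h6].
    by apply/mem_set; split; rewrite /= in_itv/=; lra.
  move=> /set_mem[]/=; rewrite !in_itv/= => h1 h2; split; apply/mem_set.
    by split; rewrite /=; lra.
  by split; rewrite /=; lra.
by ring.
Qed.

(** [box_expansion] splits [g] into the corner value and three superpositions. The corner value
    causes no error, because the weights sum to 1 and the box has area 1. The oscillation bound uses
    that each superposition is pointwise at most its mass. *)
Lemma koksma_hlawka g rho l (w D : R) : cont_mixed_partials g ->
  (forall x, x \in l -> unit_box rho x) -> \sum_(x <- l) w = 1 ->
  discrepancy_le rho l w D ->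
  (forall x, unit_box rho x ->
    (`|g x - g (rho.1 + 1, rho.2 + 1)|%:E <= box_variation (pd1 g) (pd2 g) (pd12 g) rho)%E) /\
  (`|quad_error rho l w g|%:E <= D%:E * box_variation (pd1 g) (pd2 g) (pd12 g) rho)%E.
Proof.
move=> mg lbox lw disc; have [_ [_ [_ [c1 [c2 c12]]]]] := mg.
set b := (rho.1 + 1, rho.2 + 1).
pose u1 t := \1_`[rho.1, rho.1 + 1] t * pd1 g (t, rho.2 + 1).
pose u2 s := \1_`[rho.2, rho.2 + 1] s * pd2 g (rho.1 + 1, s).
pose u3 y := \1_(unit_box rho) y * pd12 g y.
have iu1 : leb.-integrable setT (EFin \o u1).
  exact: continuous_integrable_segment (continuous_slice1 c1).
have iu2 : leb.-integrable setT (EFin \o u2).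
  exact: continuous_integrable_segment (continuous_slice2 c2).
have iu3 : leb2.-integrable setT (EFin \o u3).
  by rewrite /u3 /unit_box shifted_boxE; exact: continuous_integrable_rectangle.
pose e1 (t : R) := (t - rho.1, 1 : R).
pose e2 (s : R) := (1 : R, s - rho.2).
pose e3 (y : R * R) := (y.1 - rho.1, y.2 - rho.2).
have he1 t : u1 t != 0 -> 0 <= (e1 t).1 <= 1 /\ 0 <= (e1 t).2 <= 1.
  rewrite /u1 indicE; case: (boolP (t \in _)) => [/set_mem/=|_]; last by rewrite mul0r eqxx.
  by rewrite in_itv/= => h _; split; lra.
have he2 t : u2 t != 0 -> 0 <= (e2 t).1 <= 1 /\ 0 <= (e2 t).2 <= 1.
  rewrite /u2 indicE; case: (boolP (t \in _)) => [/set_mem/=|_]; last by rewrite mul0r eqxx.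
  by rewrite in_itv/= => h _; split; lra.
have he3 t : u3 t != 0 -> 0 <= (e3 t).1 <= 1 /\ 0 <= (e3 t).2 <= 1.
  rewrite /u3 indicE; case: (boolP (t \in _)) => [/set_mem[/= h1 h2]|_]; last by rewrite mul0r eqxx.
  by move=> _; split; lra.
have m11 : measurable_fun setT (fun t : measurableTypeR R => (e1 t).1) by exact: measurable_funB.
have m12 : measurable_fun setT (fun t : measurableTypeR R => (e1 t).2) by exact: measurable_cst.
have m21 : measurable_fun setT (fun t : measurableTypeR R => (e2 t).1) by exact: measurable_cst.
have m22 : measurable_fun setT (fun t : measurableTypeR R => (e2 t).2) by exact: measurable_funB.
have m31 : measurable_fun setT (fun t : measurableTypeR R * measurableTypeR R => (e3 t).1).
  by apply: measurable_funB.
have m32 : measurable_fun setT (fun t : measurableTypeR R * measurableTypeR R => (e3 t).2).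
  by apply: measurable_funB.
have := quad_error_superposition disc m11 m12 he1 iu1.
set h1 := fun x => _; move=> /= [i1 n1 q1].
have := quad_error_superposition disc m21 m22 he2 iu2.
set h2 := fun x => _; move=> /= [i2 n2 q2].
have := quad_error_superposition disc m31 m32 he3 iu3.
set h3 := fun x => _; move=> /= [i3 n3 q3].
have gE x : unit_box rho x -> g x = g b - h1 x - h2 x + h3 x by move=> xb; exact: box_expansion.
have [V [[n1' n2' n3'] [q1' q2' q3' VE]]] : exists V : R * R * R,
    [/\ forall x, `|h1 x| <= V.1.1, forall x, `|h2 x| <= V.1.2 & forall x, `|h3 x| <= V.2] /\ [/\
     `|quad_error rho l w h1| <= D * V.1.1, `|quad_error rho l w h2| <= D * V.1.2,
     `|quad_error rho l w h3| <= D * V.2 &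
     box_variation (pd1 g) (pd2 g) (pd12 g) rho = (V.1.1 + V.1.2 + V.2)%:E].
  exists (\int[leb]_t `|u1 t|, \int[leb]_t `|u2 t|, \int[leb2]_y `|u3 y|).
  split; split; [exact: n1|exact: n2|exact: n3|exact: q1|exact: q2|exact: q3|].
  have a1 : (\int[leb]_t `|u1 t|)%:E = (\int[leb]_t `|u1 t|%:E)%E.
    exact: EFin_Rintegral (integrable_abse iu1).
  have a2 : (\int[leb]_t `|u2 t|)%:E = (\int[leb]_t `|u2 t|%:E)%E.
    exact: EFin_Rintegral (integrable_abse iu2).
  have a3 : (\int[leb2]_t `|u3 t|)%:E = (\int[leb2]_t `|u3 t|%:E)%E.
    exact: EFin_Rintegral (integrable_abse iu3).
  rewrite /box_variation.
  transitivity (\int[leb]_t `|u1 t|%:E + \int[leb]_t `|u2 t|%:E + \int[leb2]_t `|u3 t|%:E)%E.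
    by congr (_ + _ + _)%E; apply: eq_integral => y _; rewrite normrM;
      congr (_ * _)%:E; rewrite indicE ger0_norm.
  exact: (congr2 adde (congr2 adde (esym a1) (esym a2)) (esym a3)).
rewrite VE; clear n1 n2 n3 q1 q2 q3 VE; case: V n1' n2' n3' q1' q2' q3' => -[V1 V2] V3.
move=> /= n1 n2 n3 q1 q2 q3.
clear iu1 iu2 iu3 he1 he2 he3; clearbody h1 h2 h3.
split.
  move=> x /gE ->; rewrite lee_fin.
  have -> : g b - h1 x - h2 x + h3 x - g b = - h1 x - h2 x + h3 x by ring.
  apply: (le_trans (ler_normD _ _)); apply: lerD => //.
  apply: (le_trans (ler_normB _ _)); rewrite normrN; exact: lerD.
have [ib eb] := @integrable_indic_box R rho (1, 1) ler01 ler01.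
rewrite /= mulr1 in eb.
have icb : leb2.-integrable setT (EFin \o (fun x => \1_(unit_box rho) x * g b)).
  exact: (integrableZr measurableT (g b) ib).
have qE : quad_error rho l w g =
    - quad_error rho l w h1 - quad_error rho l w h2 + quad_error rho l w h3.
  have sE : \sum_(x <- l) w * g x = g b - \sum_(x <- l) w * h1 x
      - \sum_(x <- l) w * h2 x + \sum_(x <- l) w * h3 x.
    rewrite -[g b]mul1r -lw mulr_suml -!sumrB -big_split/=.
    by apply: eq_big_seq => x /lbox /gE ->; ring.
  have iE : \int[leb2]_x (\1_(unit_box rho) x * g x) = g b
      - \int[leb2]_x (\1_(unit_box rho) x * h1 x)
      - \int[leb2]_x (\1_(unit_box rho) x * h2 x)
      + \int[leb2]_x (\1_(unit_box rho) x * h3 x).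
    have -> : g b = \int[leb2]_x (\1_(unit_box rho) x * g b).
      by rewrite RintegralZr// eb mul1r.
    have i12 := integrableB measurableT icb i1.
    have i123 := integrableB measurableT i12 i2.
    rewrite -RintegralB// -RintegralB// -RintegralD//.
    apply: eq_Rintegral => x _; rewrite indicE.
    case: (boolP (x \in _)) => [/set_mem /gE ->|_]; first by rewrite !mul1r.
    by rewrite !mul0r !subr0 addr0.
  by rewrite /quad_error sE iE; ring.
rewrite qE -EFinM lee_fin !mulrDr.
apply: (le_trans (ler_normD _ _)); apply: lerD => //.
apply: (le_trans (ler_normB _ _)); rewrite normrN; exact: lerD.
Qed.

End koksma.

(** Integrating in r first leaves the mass 1 of the kernel. When J is the indicator of y lying in
    the unit interval or box at r, local integrals summed over all positions r become the global
    integral with no loss of constant. *)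
Lemma integral_unit_kernel d (T : measurableType d) (R : realType)
    (mu : {sigma_finite_measure set T -> \bar R}) (J : T * T -> R) (k : T -> \bar R) :
  measurable_fun setT J -> (forall z, 0 <= J z) ->
  (forall y, (\int[mu]_r (J (r, y))%:E = 1)%E) ->
  measurable_fun setT k -> (forall y, (0 <= k y)%E) ->
  measurable_fun setT (fun r => \int[mu]_y ((J (r, y))%:E * k y))%E /\
  (\int[mu]_r \int[mu]_y ((J (r, y))%:E * k y) = \int[mu]_y k y)%E.
Proof.
move=> mJ J0 J1 mk k0.
pose f (z : T * T) := ((J z)%:E * k z.2)%E.
have mf : measurable_fun setT f.
  apply: emeasurable_funM; first exact/measurable_EFinP.
  exact: (measurableT_comp mk).
have f0 z : (0 <= f z)%E by rewrite mule_ge0// lee_fin.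
split; first exact: (measurable_fun_fubini_tonelli_F (m2 := mu) f mf f0).
rewrite -[LHS]/(\int[mu]_r fubini_F mu f r)%E (fubini_tonelli (m1 := mu) f mf f0).
apply: eq_integral => y _; rewrite /fubini_G /f /=.
rewrite ge0_integralZr// ?J1 ?mul1e//.
- by apply/measurable_EFinP; apply: measurableT_comp => //; exact: measurable_pair2.
- by move=> r _; rewrite lee_fin.
Qed.

Lemma indicE_ge0 T (R : realType) (A : set T) (x : T) : 0 <= \1_A x :> R.
Proof. by rewrite indicE. Qed.

(** * The variation integrated over all box positions *)

Section box_variation.
Context {R : realType}.
Local Notation leb := (@lebesgue_measure R).

Lemma measurable_indic_unit_itv d (Y : measurableType d) (r t : Y -> R) :
  measurable_fun setT r -> measurable_fun setT t ->
  measurable_fun setT (fun y => \1_`[r y, r y + 1] (t y) : R).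
Proof.
move=> mr mt.
rewrite (_ : (fun y => _) = \1_([set y | r y <= t y] `&` [set y | t y <= r y + 1])).
  apply: measurable_indic; apply: measurableI; apply: measurable_set_le => //.
  exact: measurable_funD.
apply/funext => y; rewrite !indicE; congr (_%:R); congr nat_of_bool.
apply/idP/idP => /set_mem H; apply/mem_set; move: H; rewrite /= in_itv/=.
  by case/andP.
by case=> ? ?; apply/andP.
Qed.

Lemma integral_unit_itv (t : R) : (\int[leb]_r (\1_`[r, r + 1] t : R)%:E = 1)%E.
Proof.
transitivity (\int[leb]_r (\1_`[t - 1, t] r : R)%:E)%E.
  apply: eq_integral => r _; rewrite !indicE; congr (_%:R%:E); congr nat_of_bool.
  by apply/idP/idP => /set_mem H; apply/mem_set; move: H; rewrite /= !in_itv/=; lra.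
rewrite integral_indic// setIT.
have := @lebesgue_measure_itv R `[t - 1, t].
rewrite /= lte_fin ltrBlDr ltrDl ltr01 -EFinB => H; apply: (eq_trans H).
by congr EFin; ring.
Qed.

Lemma integral_unit_box (y : R * R) : (\int[leb2]_r (\1_(unit_box r) y : R)%:E = 1)%E.
Proof.
transitivity (\int[leb2]_r (\1_(shifted_box (y.1 - 1, y.2 - 1) (1, 1)) r : R)%:E)%E.
  apply: eq_integral => r _; rewrite !indicE; congr (_%:R%:E); congr nat_of_bool.
  by apply/idP/idP => /set_mem[/= H1 H2]; apply/mem_set; split; rewrite /=; lra.
have ms := @measurable_shifted_box R (y.1 - 1, y.2 - 1) (1, 1).
rewrite integral_indic// setIT.
have := @leb2_shifted_box R (y.1 - 1, y.2 - 1) (1, 1) ler01 ler01.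
by rewrite mulr1; exact.
Qed.

Lemma measurable_indic_unit_box :
  measurable_fun setT (fun z : (R * R) * (R * R) => \1_(unit_box z.1) z.2 : R).
Proof.
by apply: measurable_indic_box; do ?apply: measurableT_comp => //; exact: measurable_cst.
Qed.

(** In an edge term, the coordinate of [rho] along the edge is handled by [integral_unit_kernel],
    while the transverse one enters only as a translation by 1. Each term therefore gives exactly
    one L1-norm. *)
Lemma integral_box_variation (h1 h2 h12 : R * R -> R) :
  measurable_fun setT h1 -> measurable_fun setT h2 -> measurable_fun setT h12 ->
  (\int[leb2]_rho box_variation h1 h2 h12 rho = L1norm h1 + L1norm h2 + L1norm h12)%E.
Proof.
move=> m1 m2 m12.
pose f1 (z : (R * R) * R) := (\1_`[z.1.1, z.1.1 + 1] z.2 * `|h1 (z.2, z.1.2 + 1)|)%:E.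
pose f2 (z : (R * R) * R) := (\1_`[z.1.2, z.1.2 + 1] z.2 * `|h2 (z.1.1 + 1, z.2)|)%:E.
have f10 z : (0 <= f1 z)%E by rewrite lee_fin mulr_ge0// indicE.
have f20 z : (0 <= f2 z)%E by rewrite lee_fin mulr_ge0// indicE.
have m11 : measurable_fun setT (fun z : (R * R) * R => z.1.1).
  by apply: measurableT_comp.
have m12' : measurable_fun setT (fun z : (R * R) * R => z.1.2).
  by apply: measurableT_comp.
have mf1 : measurable_fun setT f1.
  apply/measurable_EFinP; apply: measurable_funM.
    exact: measurable_indic_unit_itv.
  apply: measurableT_comp => //; apply: measurableT_comp => //.
  by apply: measurable_fun_pair => //; apply: measurable_funD.
have mf2 : measurable_fun setT f2.
  apply/measurable_EFinP; apply: measurable_funM.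
    exact: measurable_indic_unit_itv.
  apply: measurableT_comp => //; apply: measurableT_comp => //.
  by apply: measurable_fun_pair => //; apply: measurable_funD.
have mJ : measurable_fun setT (fun z : R * R => \1_`[z.1, z.1 + 1] z.2 : R).
  exact: measurable_indic_unit_itv.
pose g1 (rho : R * R) := (\int[leb]_t f1 (rho, t))%E.
pose g2 (rho : R * R) := (\int[leb]_t f2 (rho, t))%E.
pose g3 (rho : R * R) := (\int[leb2]_y ((\1_(unit_box rho) y)%:E * `|h12 y|%:E))%E.
have mg1 : measurable_fun setT g1 := measurable_fun_fubini_tonelli_F (m2 := leb) f1 mf1 f10.
have mg2 : measurable_fun setT g2 := measurable_fun_fubini_tonelli_F (m2 := leb) f2 mf2 f20.
have mh12 : measurable_fun setT (fun y => `|h12 y|%:E).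
  by apply/measurable_EFinP; exact: measurableT_comp.
have h120 y : (0 <= `|h12 y|%:E)%E by rewrite lee_fin.
have [mg3 e3] := integral_unit_kernel (mu := leb2) measurable_indic_unit_box
  (fun z => indicE_ge0 _ _ _) integral_unit_box mh12 h120.
have g10 rho : (0 <= g1 rho)%E by exact: integral_ge0.
have g20 rho : (0 <= g2 rho)%E by exact: integral_ge0.
have g30 rho : (0 <= g3 rho)%E.
  by apply: integral_ge0 => y _; rewrite mule_ge0// lee_fin// indicE.
have -> : (\int[leb2]_rho box_variation h1 h2 h12 rho =
    \int[leb2]_rho (g1 rho + g2 rho + g3 rho))%E.
  by apply: eq_integral => rho _; rewrite /box_variation; congr (_ + _ + _)%E.
rewrite ge0_integralD//; last 2 first.
- by move=> rho _; rewrite adde_ge0.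
- exact: emeasurable_funD.
rewrite ge0_integralD//; congr (_ + _ + _)%E; last exact: e3.
- have mh1 : measurable_fun setT (fun y => `|h1 y|%:E).
    by apply/measurable_EFinP; exact: measurableT_comp.
  have H0 z : (0 <= `|h1 z|%:E)%E by rewrite lee_fin.
  rewrite /L1norm [LHS](fubini_tonelli2 (m1 := leb) (m2 := leb) g1 mg1 g10).
  rewrite [RHS](fubini_tonelli2 (m1 := leb) (m2 := leb) _ mh1 H0).
  rewrite -[RHS](ge0_integral_shift 1); last 2 first.
  + exact: (measurable_fun_fubini_tonelli_G (m1 := leb) _ mh1 H0).
  + by move=> x; exact: integral_ge0.
  apply: eq_integral => s _; rewrite /fubini_G.
  have mk : measurable_fun setT (fun t : R => `|h1 (t, s + 1)|%:E).
    by apply: (measurableT_comp mh1); exact: measurable_pair2.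
  rewrite -(integral_unit_kernel (mu := leb) mJ (fun z => indicE_ge0 _ _ _) integral_unit_itv mk (fun z => H0 _)).2.
  by apply: eq_integral => r _; apply: eq_integral => t _; rewrite /f1 EFinM.
- have mh2 : measurable_fun setT (fun y => `|h2 y|%:E).
    by apply/measurable_EFinP; exact: measurableT_comp.
  have H0 z : (0 <= `|h2 z|%:E)%E by rewrite lee_fin.
  rewrite /L1norm [LHS](fubini_tonelli1 (m1 := leb) (m2 := leb) g2 mg2 g20).
  rewrite [RHS](fubini_tonelli1 (m1 := leb) (m2 := leb) _ mh2 H0).
  rewrite -[RHS](ge0_integral_shift 1); last 2 first.
  + exact: (measurable_fun_fubini_tonelli_F (m2 := leb) _ mh2 H0).
  + by move=> x; exact: integral_ge0.
  apply: eq_integral => s _; rewrite /fubini_F.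
  have mk : measurable_fun setT (fun t : R => `|h2 (s + 1, t)|%:E).
    by apply: (measurableT_comp mh2); exact: measurable_pair1.
  rewrite -(integral_unit_kernel (mu := leb) mJ (fun z => indicE_ge0 _ _ _) integral_unit_itv mk (fun z => H0 _)).2.
  by apply: eq_integral => r _; apply: eq_integral => t _; rewrite /f2 EFinM.
Qed.

End box_variation.

(** * Parseval frames *)

Section complex_parts.
Context {R : realType}.
Implicit Types z w : R[i].

Lemma cRe_conj z : cRe z^* = cRe z. Proof. by case: z. Qed.
Lemma cIm_conj z : cIm z^* = - cIm z. Proof. by case: z. Qed.
Lemma cReD z w : cRe (z + w) = cRe z + cRe w. Proof. by case: z; case: w. Qed.
Lemma cImD z w : cIm (z + w) = cIm z + cIm w. Proof. by case: z; case: w. Qed.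
Lemma cReM z w : cRe (z * w) = cRe z * cRe w - cIm z * cIm w.
Proof. by case: z; case: w. Qed.
Lemma cImM z w : cIm (z * w) = cRe z * cIm w + cIm z * cRe w.
Proof. by case: z => a b; case: w => c d. Qed.

Lemma cabs2_ge0 z : 0 <= cabs2 z.
Proof. by rewrite addr_ge0// sqr_ge0. Qed.

Lemma cabs2M z w : cabs2 (z * w) = cabs2 z * cabs2 w.
Proof. by rewrite /cabs2 cReM cImM; ring. Qed.

Lemma cabs2_conj z : cabs2 z^* = cabs2 z.
Proof. by rewrite /cabs2 cRe_conj cIm_conj sqrrN. Qed.

Lemma cRe_sqr_le z : cRe z ^+ 2 <= cabs2 z.
Proof. by rewrite /cabs2 lerDl sqr_ge0. Qed.

End complex_parts.

Section inner_product.
Context {R : realType} (H : lmodType R[i]) (ip : H -> H -> R[i]).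
Hypothesis ipH : inner_product ip.
Implicit Types x y z : H.

Lemma ip_sym x y : ip y x = (ip x y)^*. Proof. by case: ipH. Qed.

Lemma ipDl x y z : ip (x + y) z = ip x z + ip y z.
Proof. by have [lin _ _ _] := ipH; rewrite -[x]scale1r lin scale1r mul1r. Qed.

Lemma ip0l z : ip 0 z = 0.
Proof. by apply: (addrI (ip 0 z)); rewrite -ipDl !addr0. Qed.

Lemma ipZl (a : R[i]) x z : ip (a *: x) z = a * ip x z.
Proof. by have [lin _ _ _] := ipH; rewrite -[a *: x]addr0 lin ip0l addr0. Qed.

Lemma ipBl x y z : ip (x - y) z = ip x z - ip y z.
Proof. by rewrite ipDl -scaleN1r ipZl mulN1r. Qed.

Lemma ipDr x y z : ip z (x + y) = ip z x + ip z y.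
Proof. by rewrite (ip_sym (x + y)) ipDl rmorphD /= -(ip_sym x) -(ip_sym y). Qed.

Lemma ipBr x y z : ip z (x - y) = ip z x - ip z y.
Proof. by rewrite (ip_sym (x - y)) ipBl rmorphB /= -(ip_sym x) -(ip_sym y). Qed.

Lemma ipZr (a : R[i]) x z : ip z (a *: x) = a^* * ip z x.
Proof. by rewrite (ip_sym (a *: x)) ipZl rmorphM /= -(ip_sym x). Qed.

Lemma cRe_ip_sym x y : cRe (ip y x) = cRe (ip x y).
Proof. by rewrite ip_sym cRe_conj. Qed.

Lemma cRe_ip_ge0 x : 0 <= cRe (ip x x).
Proof. by have [_ _ /(_ x) + _] := ipH; rewrite lecE => /andP[]. Qed.

Lemma sqr_ipnorm x : ipnorm ip x ^+ 2 = cRe (ip x x).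
Proof. by rewrite sqr_sqrtr// cRe_ip_ge0. Qed.

Lemma cRe_ip_polar x y :
  cRe (ip x y) = 4^-1 * (cRe (ip (x + y) (x + y)) - cRe (ip (x - y) (x - y))).
Proof.
rewrite ipBl !ipBr ipDl !ipDr.
have cReN (z : R[i]) : cRe (- z) = - cRe z by case: z.
by rewrite !(cReD, cReN) (cRe_ip_sym x y); field.
Qed.

(** [weakly_measurable] for any parameter space: the kernels depend on several points of the plane
    at once. *)
Definition weakly_measurable_fun d (T : measurableType d) (Y : T -> H) :=
  forall f, measurable_fun setT (fun t => cRe (ip f (Y t))) /\
            measurable_fun setT (fun t => cIm (ip f (Y t))).

Lemma weakly_measurableD d (T : measurableType d) (Y Z : T -> H) :
  weakly_measurable_fun Y -> weakly_measurable_fun Z ->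
  weakly_measurable_fun (fun t => Y t + Z t).
Proof.
move=> mY mZ f; have [Y1 Y2] := mY f; have [Z1 Z2] := mZ f.
under eq_fun do rewrite ipDr cReD.
under [X in _ /\ measurable_fun _ X]eq_fun do rewrite ipDr cImD.
by split; exact: measurable_funD.
Qed.

Lemma weakly_measurableZ d (T : measurableType d) (Y : T -> H) (a : R[i]) :
  weakly_measurable_fun Y -> weakly_measurable_fun (fun t => a *: Y t).
Proof.
move=> mY f; have [Y1 Y2] := mY f.
under eq_fun do rewrite ipZr cReM.
under [X in _ /\ measurable_fun _ X]eq_fun do rewrite ipZr cImM.
by split; [apply: measurable_funB|apply: measurable_funD];
  apply: measurable_funM => //; exact: measurable_cst.
Qed.

Lemma weakly_measurable_comp d d' (T : measurableType d) (T' : measurableType d')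
    (Y : T -> H) (h : T' -> T) : measurable_fun setT h ->
  weakly_measurable_fun Y -> weakly_measurable_fun (fun t => Y (h t)).
Proof.
move=> mh mY f; have [Y1 Y2] := mY f.
by split; [exact: (measurableT_comp Y1)|exact: (measurableT_comp Y2)].
Qed.

Hypothesis sepH : ip_separable ip.

(* By separability [|y|^2] is the supremum over a countable dense family of the
   functions [2 Re <d_k, y> - |d_k|^2], which are linear in [y] up to constants. *)
Lemma measurable_ip_diag d (T : measurableType d) (Y : T -> H) :
  weakly_measurable_fun Y -> measurable_fun setT (fun t => cRe (ip (Y t) (Y t))).
Proof.
move=> mY; have [e dense] := sepH.
pose s k t := 2 * cRe (ip (e k) (Y t)) - cRe (ip (e k) (e k)).
(* The gap is a squared distance: never negative, and arbitrarily small for suitable k by density.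
   So the squared norm exceeds a exactly when some [s k t] does. *)
have sE k t : cRe (ip (Y t) (Y t)) - s k t = ipnorm ip (Y t - e k) ^+ 2.
  have cReN (z : R[i]) : cRe (- z) = - cRe z by case: z.
  rewrite sqr_ipnorm ipBl !ipBr !cReD !cReN cReD cReN (cRe_ip_sym (e k) (Y t)) /s.
  by ring.
have ms k : measurable_fun setT (s k).
  apply: measurable_funB; last exact: measurable_cst.
  by apply: measurable_funM; [exact: measurable_cst|exact: (mY (e k)).1].
apply: (measurability _ (RGenOInfty.measurableE R)) => _ [_ [a ->] <-].
rewrite (_ : _ `&` _ = \bigcup_k (setT `&` s k @^-1` `]a, +oo[)).
  by apply: bigcupT_measurable => k; exact: ms.
apply/seteqP; split => [t [_]|t [k _ [_]]] /=; rewrite !in_itv/= !andbT.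
  rewrite -subr_gt0 => ta.
  have := ta; rewrite -sqrtr_gt0 => /(dense (Y t))[k kt].
  suff ask : a < s k t by exists k => //; split => //=; rewrite in_itv/= andbT.
  rewrite -subr_gt0.
  have : ipnorm ip (Y t - e k) ^+ 2 < cRe (ip (Y t) (Y t)) - a.
    by rewrite -[ltRHS]sqr_sqrtr ?ltW// ltr_pXn2r// nnegrE sqrtr_ge0.
  by rewrite -sE; lra.
move=> ast; split => //; apply: (lt_le_trans ast).
by rewrite -subr_ge0 sE sqr_ge0.
Qed.

Lemma measurable_cRe_ip d (T : measurableType d) (Y Z : T -> H) :
  weakly_measurable_fun Y -> weakly_measurable_fun Z ->
  measurable_fun setT (fun t => cRe (ip (Y t) (Z t))).
Proof.
move=> mY mZ; under eq_fun do rewrite cRe_ip_polar.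
apply: measurable_funM; first exact: measurable_cst.
apply: measurable_funB; apply: measurable_ip_diag.
  exact: weakly_measurableD.
under eq_fun do rewrite -[- _]scaleN1r.
by apply: weakly_measurableD => //; exact: weakly_measurableZ.
Qed.

Lemma measurable_cIm_ip d (T : measurableType d) (Y Z : T -> H) :
  weakly_measurable_fun Y -> weakly_measurable_fun Z ->
  measurable_fun setT (fun t => cIm (ip (Y t) (Z t))).
Proof.
move=> mY mZ.
have -> : (fun t => cIm (ip (Y t) (Z t))) = (fun t => cRe (ip ((- 'i%C) *: Y t) (Z t))).
  by apply/funext => t; rewrite ipZl cReM /cRe /cIm /=; ring.
by apply: measurable_cRe_ip => //; exact: weakly_measurableZ.
Qed.

End inner_product.

Definition cmeasurable d (T : measurableType d) (R : realType) (h : T -> R[i]) :=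
  measurable_fun setT (fun t => cRe (h t)) /\ measurable_fun setT (fun t => cIm (h t)).

Lemma cconjM (R : realType) (z w : R[i]) : (z * w)^* = z^* * w^*.
Proof. exact: rmorphM. Qed.

Section cmeasurable.
Context d (T : measurableType d) (R : realType).
Implicit Types h k : T -> R[i].

Lemma cmeasurableM h k : cmeasurable h -> cmeasurable k ->
  cmeasurable (fun t => h t * k t).
Proof.
move=> [h1 h2] [k1 k2]; split.
  under eq_fun do rewrite cReM.
  by apply: measurable_funB; exact: measurable_funM.
under eq_fun do rewrite cImM.
by apply: measurable_funD; exact: measurable_funM.
Qed.

Lemma cmeasurable_conj h : cmeasurable h -> cmeasurable (fun t => (h t)^*).
Proof.
move=> [h1 h2]; split; first by under eq_fun do rewrite cRe_conj.
by under eq_fun do rewrite cIm_conj; exact: measurableT_comp.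
Qed.

Lemma measurable_cabs2 h : cmeasurable h -> measurable_fun setT (fun t => cabs2 (h t)).
Proof. by move=> [h1 h2]; apply: measurable_funD; exact: measurable_funX. Qed.

End cmeasurable.

Lemma integrable_tensor d (T : measurableType d) (R : realType)
    (mu : {sigma_finite_measure set T -> \bar R}) (U : T -> R) (g : T * T -> R) :
  mu.-integrable setT (EFin \o U) -> (forall x, 0 <= U x) ->
  measurable_fun setT g -> (forall z, `|g z| <= U z.1 * U z.2) ->
  (sigma_prod mu mu).-integrable setT (EFin \o g).
Proof.
move=> iU U0 mg gU.
have mU : measurable_fun setT (EFin \o U) := measurable_int _ iU.
have IU : (\int[mu]_y (U y)%:E < +oo)%E.
  case/integrableP : iU => _; apply: le_lt_trans; apply: ge0_le_integral => //=.
  - by move=> y _; rewrite lee_fin.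
  - by apply/measurable_EFinP; apply: measurableT_comp => //; exact/measurable_EFinP.
  - by move=> y _; rewrite lee_fin ler_norm.
have fin : (\int[mu]_y (U y)%:E)%E \is a fin_num.
  by rewrite ge0_fin_numE// integral_ge0// => y _; rewrite lee_fin.
apply/(integrable12ltyP mu mu); first exact/measurable_EFinP.
apply: (@le_lt_trans _ _ (\int[mu]_x ((U x)%:E * \int[mu]_y (U y)%:E))%E).
  apply: ge0_le_integral => //=.
  - by move=> y _; exact: integral_ge0.
  - apply: (measurable_integral2 mu (f := fun z => `|g z|%:E)).
    by apply/measurable_EFinP; exact: measurableT_comp.
  - by apply: emeasurable_funM => //; exact: measurable_cst.
  - move=> x _; rewrite -ge0_integralZl//; last 2 first.
    + by move=> y _; rewrite lee_fin.
    + by rewrite lee_fin.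
    apply: ge0_le_integral => //=.
    + apply/measurable_EFinP; apply: measurableT_comp => //.
      by apply: measurableT_comp => //; exact: measurable_pair1.
    + by apply: emeasurable_funM => //; exact: measurable_cst.
    + by move=> y _; rewrite -EFinM lee_fin (gU (x, y)).
rewrite ge0_integralZr//; last 2 first.
- by move=> y _; rewrite lee_fin.
- by apply: integral_ge0 => y _; rewrite lee_fin.
by rewrite lte_mul_pinfty// integral_ge0// => y _; rewrite lee_fin.
Qed.

(** * The squared frame coefficient as a double integral *)

Section parseval.
Context {R : realType} (H : lmodType R[i]) (ip : H -> H -> R[i]) (psi : R * R -> H).
Hypotheses (ipH : inner_product ip) (sepH : ip_separable ip).
Hypothesis frame : continuous_parseval_frame ip psi.
Implicit Types f g : H.

Lemma cmeasurable_frame f : cmeasurable (fun eta => ip f (psi eta)).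
Proof. by case: frame => /(_ f). Qed.

Lemma cmeasurable_ip_psi d (T : measurableType d) (a b : T -> R * R) :
  measurable_fun setT a -> measurable_fun setT b ->
  cmeasurable (fun t => ip (psi (a t)) (psi (b t))).
Proof.
move=> ma mb; case: frame => wm _; split.
  by apply: measurable_cRe_ip => //; exact: (weakly_measurable_comp (Y := psi)).
by apply: measurable_cIm_ip => //; exact: (weakly_measurable_comp (Y := psi)).
Qed.

Lemma parseval f : leb2.-integrable setT (EFin \o (fun eta => cabs2 (ip f (psi eta)))) /\
  \int[leb2]_eta cabs2 (ip f (psi eta)) = cRe (ip f f).
Proof.
have [_ /(_ f)] := frame; rewrite sqr_ipnorm// => E.
split; last by rewrite /Rintegral -E.
apply/integrableP; split.
  by apply/measurable_EFinP; apply: measurable_cabs2; exact: cmeasurable_frame.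
rewrite (_ : integral _ _ _ = (cRe (ip f f))%:E) ?ltry// E.
by apply: eq_integral => x _ /=; rewrite ger0_norm// cabs2_ge0.
Qed.

(** Real parts are enough: a complex factor in front of the integrand can be absorbed into the
    vector [f]. *)
Lemma parseval_polar f g :
  leb2.-integrable setT
    (EFin \o (fun eta => cRe (ip f (psi eta) * (ip g (psi eta))^*))) /\
  \int[leb2]_eta cRe (ip f (psi eta) * (ip g (psi eta))^*) = cRe (ip f g).
Proof.
have [iD eD] := parseval (f + g); have [iB eB] := parseval (f - g).
have hE : (fun eta => cRe (ip f (psi eta) * (ip g (psi eta))^*)) =
    (fun eta => 4^-1 * (cabs2 (ip (f + g) (psi eta)) - cabs2 (ip (f - g) (psi eta)))).
  apply/funext => eta; rewrite cReM cRe_conj cIm_conj ipDl// ipBl// /cabs2 !(cReD, cImD).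
  have cN (z : R[i]) : cRe (- z) = - cRe z /\ cIm (- z) = - cIm z by case: z.
  by rewrite (cN _).1 (cN _).2; field.
have iDB := integrableB measurableT iD iB.
rewrite hE; split; first exact: (integrableZl measurableT (4^-1) iDB).
rewrite cRe_ip_polar// -eD -eB -(RintegralB measurableT iD iB).
exact: (RintegralZl (4^-1) measurableT iDB).
Qed.

(** Exchanging the two entries of z conjugates the complex product. Its real part is therefore
    symmetric, as Schur's test requires, and accessible to real calculus. *)
Definition frame_kernel f (z : (R * R) * (R * R)) (x : R * R) : R :=
  cRe (ip f (psi z.2) * (ip f (psi z.1))^* * Kker ip psi z.1 z.2 x).

Lemma frame_kernel_sym f eta nu x :
  frame_kernel f (eta, nu) x = frame_kernel f (nu, eta) x.
Proof.
rewrite /frame_kernel /Kker /Rker /= -[LHS]cRe_conj; congr (cRe _).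
by rewrite !rmorphM/= -!ip_sym//; ring.
Qed.

Lemma measurable_frame_kernel f :
  measurable_fun setT (fun y => frame_kernel f y.1 y.2).
Proof.
suff [] : cmeasurable (fun y : (R * R) * (R * R) * (R * R) =>
  ip f (psi y.1.2) * (ip f (psi y.1.1))^* * Kker ip psi y.1.1 y.1.2 y.2) by [].
have m11 : measurable_fun setT (fun y : (R * R) * (R * R) * (R * R) => y.1.1).
  exact: measurableT_comp.
have m12 : measurable_fun setT (fun y : (R * R) * (R * R) * (R * R) => y.1.2).
  exact: measurableT_comp.
have [f1 f2] := cmeasurable_frame f.
apply: cmeasurableM; first apply: cmeasurableM.
- by split; [exact: (measurableT_comp f1)|exact: (measurableT_comp f2)].
- apply: cmeasurable_conj.
  by split; [exact: (measurableT_comp f1)|exact: (measurableT_comp f2)].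
- by apply: cmeasurableM; apply: cmeasurable_ip_psi.
Qed.

Lemma frame_kernel_repr f x :
  (sigma_prod leb2 leb2).-integrable setT (EFin \o (fun z => frame_kernel f z x)) /\
  \int[sigma_prod leb2 leb2]_z frame_kernel f z x = cabs2 (ip f (psi x)).
Proof.
(* The modulus of the kernel is a product of factors |<f, psi_eta>| |<psi_x, psi_eta>|, one for each
   entry of z, and each is at most [U], which is integrable by Parseval. *)
pose U eta := cabs2 (ip f (psi eta)) + cabs2 (ip (psi x) (psi eta)).
have U0 eta : 0 <= U eta by rewrite addr_ge0// cabs2_ge0.
have iU : leb2.-integrable setT (EFin \o U).
  exact: (integrableD measurableT (parseval f).1 (parseval (psi x)).1).
have mg : measurable_fun setT (fun z => frame_kernel f z x).
  have := measurableT_comp (measurable_frame_kernel f) (measurable_pair2 x); exact.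
have gU z : `|frame_kernel f z x| <= U z.1 * U z.2.
  rewrite -ler_sqr ?nnegrE ?mulr_ge0// real_normK ?num_real//; apply: (le_trans (cRe_sqr_le _)).
  rewrite /Kker /Rker !cabs2M cabs2_conj exprMn.
  rewrite (ip_sym ipH (psi x) (psi z.2)) cabs2_conj.
  set a := cabs2 _; set b := cabs2 _; set c := cabs2 _; set e := cabs2 _.
  have -> : a * b * (c * e) = (b * c) * (a * e) by ring.
  apply: ler_pM; rewrite ?mulr_ge0 ?cabs2_ge0//.
    by have := cabs2_ge0 (ip f (psi z.1)); have := cabs2_ge0 (ip (psi x) (psi z.1));
       rewrite -/b -/c /U -/b -/c; nra.
  by have := cabs2_ge0 (ip f (psi z.2)); have := cabs2_ge0 (ip (psi x) (psi z.2));
       rewrite -/a -/e /U -/a -/e; nra.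
have ig := integrable_tensor iU U0 mg gU.
split => //.
have [_ _ _ e1] := Rintegral_fubini ig.
apply: (eq_trans e1).
pose w nu := ip f (psi nu) * ip (psi nu) (psi x).
(* With the factor [w nu] moved into the vector, the eta-integral is a Parseval integral. Its value
   is again a Parseval integrand in nu, now for the vector [ip f (psi x) *: psi x]. *)
have inner nu : \int[leb2]_eta frame_kernel f (eta, nu) x =
    cRe (ip f (psi nu) * (ip (ip f (psi x) *: psi x) (psi nu))^*).
  have [_ E] := parseval_polar (w nu *: psi x) f.
  transitivity (cRe (ip (w nu *: psi x) f)).
    rewrite -E; apply: eq_Rintegral => eta _; congr (cRe _).
    by rewrite /Kker /Rker /= ipZl// /w; ring.
  by rewrite !(ipZl ipH) cconjM -!(ip_sym ipH) /w; congr (cRe _); ring.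
under eq_Rintegral do rewrite inner.
have [_ ->] := parseval_polar f (ip f (psi x) *: psi x).
by rewrite ipZr// cReM cRe_conj cIm_conj /cabs2; ring.
Qed.

End parseval.

(** * The sampling set *)

Section points.
Context {R : realType} (L : set (R * R)).
Hypothesis finL : forall rho : R * R, finite_set (L `&` unit_box rho).
Hypothesis NL : forall rho : R * R, 1 <= Nrho L rho.
Implicit Types (rho x e : R * R).

Definition box_pts rho : seq (R * R) := fset_set (L `&` unit_box rho).

Lemma mem_box_pts rho x : x \in box_pts rho <-> L x /\ unit_box rho x.
Proof. by rewrite -[x \in box_pts rho]/(x \in fset_set _) in_fset_set// in_setE. Qed.

Lemma uniq_box_pts rho : uniq (box_pts rho). Proof. exact: fset_uniq. Qed.

Lemma NrhoE rho : Nrho L rho = (size (box_pts rho))%:R.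
Proof. by []. Qed.

Lemma Nrho_gt0 rho : 0 < Nrho L rho. Proof. exact: lt_le_trans (NL rho). Qed.

Lemma sum_box_weight rho : \sum_(x <- box_pts rho) (Nrho L rho)^-1 = 1.
Proof.
rewrite big_const_seq count_predT iter_addr_0 -mulr_natl -NrhoE.
by rewrite mulfV// gt_eqF// Nrho_gt0.
Qed.

Lemma count_pts_box rho e : e.1 <= 1 -> e.2 <= 1 ->
  count_pts (L `&` shifted_box rho e) =
  \sum_(x <- box_pts rho) \1_(shifted_box rho e) x :> R.
Proof.
move=> e1 e2.
have sub : L `&` shifted_box rho e `<=` L `&` unit_box rho.
  by apply: setIS; exact: subset_shifted_box.
have fin : finite_set (L `&` shifted_box rho e) by exact: sub_finite_set (finL rho).
rewrite /count_pts -sum1_size natr_sum.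
rewrite (perm_big [seq x <- box_pts rho | x \in shifted_box rho e])/=; last first.
  apply: uniq_perm; rewrite ?filter_uniq ?uniq_box_pts ?fset_uniq// => x.
  rewrite mem_filter -[x \in enum_fset _]/(x \in fset_set _) in_fset_set//.
  apply/idP/andP => [/set_mem[Lx xb]|[/set_mem xb /mem_box_pts[Lx _]]].
    by split; [exact/mem_set|apply/mem_box_pts; exact: sub].
  exact/mem_set.
rewrite big_filter big_mkcond; apply: eq_bigr => x _; rewrite indicE.
by case: (_ \in _).
Qed.

Lemma discrepancy_le_Dshift (D : R) rho : (Dshift L <= D%:E)%E ->
  discrepancy_le rho (box_pts rho) (Nrho L rho)^-1 D.
Proof.
move=> LD e e1 e2; rewrite -mulr_sumr -count_pts_box; last 2 first.
- by case/andP: e1.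
- by case/andP: e2.
rewrite mulrC -lee_fin; apply: le_trans LD; apply: ereal_sup_ubound.
by exists rho => //; exists e.
Qed.

Lemma Dshift_le1 : (Dshift L <= 1)%E.
Proof.
apply: ge_ereal_sup => _ [rho _ [e [/andP[a0 a1] /andP[b0 b1]] <-]].
rewrite lee_fin.
have N0 := Nrho_gt0 rho.
have h1 : 0 <= count_pts (L `&` shifted_box rho e) / Nrho L rho <= 1.
  rewrite divr_ge0 ?ler0n ?(ltW N0)//= ler_pdivrMr// mul1r count_pts_box// NrhoE.
  rewrite -sum1_size natr_sum; apply: ler_sum => x _.
  by rewrite indicE; case: (_ \in _).
have h2 : 0 <= e.1 * e.2 <= 1 by rewrite mulr_ge0// mulr_ile1.
by rewrite ler_norml; lra.
Qed.

Lemma exists_box_pt rho : exists2 x, L x & unit_box rho x.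
Proof.
have : (0 < size (box_pts rho))%N by rewrite -(ltr_nat R) -NrhoE Nrho_gt0.
rewrite -has_predT => /hasP[x /mem_box_pts[Lx xb] _].
by exists x.
Qed.

(** A box of size zero placed at a point of [L] has area 0 but contains that point. Positivity is
    what later excludes an infinite [Omega]. *)
Lemma Dshift_gt0 : (0 < Dshift L)%E.
Proof.
have [x Lx xb] := exists_box_pt (0, 0).
have x0 : unit_box x x by split; rewrite /= lexx lerDl ler01.
apply: (@lt_le_trans _ _ ((Nrho L x)^-1)%:E).
  by rewrite lte_fin invr_gt0 Nrho_gt0.
apply: (@le_trans _ _
   (`|count_pts (L `&` shifted_box x (0, 0)) / Nrho L x - 0 * 0|)%:E); last first.
  by apply: ereal_sup_ubound; exists x => //; exists (0, 0) => //=; rewrite lexx ler01.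
rewrite mulr0 subr0 lee_fin ger0_norm ?divr_ge0 ?ler0n ?(ltW (Nrho_gt0 x))//.
rewrite ler_peMl ?invr_ge0 ?(ltW (Nrho_gt0 x))//.
have xx : shifted_box x (0, 0) x by split; rewrite /= addr0 lexx.
rewrite count_pts_box// (bigD1_seq x)//= ?uniq_box_pts//; last exact/mem_box_pts.
rewrite indicE mem_set// lerDl; apply: sumr_ge0 => y _.
by rewrite indicE.
Qed.

(** A finite set would miss the unit box placed to the right of the sum of all |x.1|. Being infinite
    and countable, [L] can be enumerated by all natural numbers. *)
Lemma infinite_points : infinite_set L.
Proof.
move=> fL.
pose M : R := \sum_(x <- fset_set L) `|x.1|.
have [x Lx [/= /andP[xM _] _]] := exists_box_pt (M + 1, 0).
have : x.1 <= M.
  rewrite /M (bigD1_seq x) ?fset_uniq//=; last first.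
    by rewrite -[_ \in _]/(x \in fset_set L) in_fset_set//; exact/mem_set.
  by rewrite (le_trans (ler_norm _))// lerDl sumr_ge0.
by lra.
Qed.

Lemma countable_points : countable L.
Proof.
have -> : L = \bigcup_(q : int * int) (L `&` unit_box (q.1%:~R, q.2%:~R)).
  apply/seteqP; split => [x Lx|x [q _ []]//].
  exists (Num.floor x.1, Num.floor x.2) => //; split => //=.
  have f1 := floor_itv x.1; have f2 := floor_itv x.2.
  move: f1 f2; rewrite !intrD => f1 f2.
  by split => /=; lra.
apply: bigcup_countable => // q _; exact: finite_set_countable.
Qed.

Lemma exists_enum_points : exists e : nat -> R * R, set_bij [set: nat] L e.
Proof.
have /card_set_bijP[f] : ([set: nat] #= L)%card.
  rewrite card_eq_le; apply/andP; split; last exact: countable_points.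
  exact/infiniteP/infinite_points.
by exists f.
Qed.

Variable e : nat -> R * R.
Hypothesis e_bij : set_bij [set: nat] L e.

Lemma enum_in k : L (e k).
Proof. by case: e_bij => /(_ k I). Qed.

Lemma enum_inj : injective e.
Proof. by case: e_bij => _ inj _ j k jk; apply: (inj j k _ _ jk); exact: mem_set. Qed.

(** A box holds finitely many points, so its sum is reached after finitely many indices of the
    enumeration. Sums over a list moving with [rho] become limits of sums with fixed index range. *)
Lemma sum_box_enum rho : exists n0, forall n, (n0 <= n)%N -> forall h : R * R -> R,
  \sum_(k < n) \1_(unit_box rho) (e k) * h (e k) = \sum_(x <- box_pts rho) h x.
Proof.
have /choice[ix ixP] : forall x, exists k, L x -> e k = x.
  move=> x; case: (pselect (L x)) => [Lx|]; last by exists 0%N.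
  by case: e_bij => _ _ /(_ x Lx)[k _ <-]; exists k.
(* The successor is needed because the sum runs over k < n. *)
exists (\max_(x <- box_pts rho) (ix x).+1)%N => n n0 h.
rewrite -(big_mkord xpredT (fun k => \1_(unit_box rho) (e k) * h (e k))).
rewrite (perm_big [seq e k | k <- index_iota 0 n & e k \in unit_box rho])/=; last first.
  apply: uniq_perm; first exact: uniq_box_pts.
    by rewrite map_inj_uniq ?filter_uniq ?iota_uniq//; exact: enum_inj.
  move=> x; apply/idP/mapP => [xb|[k + ->]].
    have [Lx bx] := (mem_box_pts rho x).1 xb.
    exists (ix x); last by rewrite ixP.
    rewrite mem_filter ixP// mem_set//= mem_index_iota/=.
    by apply: leq_trans n0; rewrite (bigD1_seq x)//= ?uniq_box_pts// leq_maxl.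
  rewrite mem_filter => /andP[/set_mem ek _]; apply/mem_box_pts; split => //.
  exact: enum_in.
rewrite big_map big_filter [RHS]big_mkcond; apply: eq_bigr => k _.
by rewrite indicE; case: (_ \in _); rewrite ?mul1r ?mul0r.
Qed.

Lemma measurable_box_sum d (Y : measurableType d) (r : Y -> R * R)
    (h : Y -> R * R -> R) :
  measurable_fun setT r -> (forall x, measurable_fun setT (h^~ x)) ->
  measurable_fun setT (fun y => \sum_(x <- box_pts (r y)) h y x).
Proof.
move=> mr mh.
apply: (@measurable_fun_cvg _ _ _ _
  (fun n y => \sum_(k < n) \1_(unit_box (r y)) (e k) * h y (e k))) => [n|y _].
  apply: measurable_sum => k; apply: measurable_funM => //.
  apply: measurable_indic_box => //; try exact: measurable_cst.
  - exact: (measurableT_comp measurable_fst mr).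
  - exact: (measurableT_comp measurable_snd mr).
have [n0 n0P] := sum_box_enum (r y).
apply: cvg_near_cst; exists n0 => // n /= n0n; exact: n0P.
Qed.

Lemma measurable_Nrho : measurable_fun setT (Nrho L).
Proof.
rewrite (_ : Nrho L = fun rho => \sum_(x <- box_pts rho) 1).
  by apply: (measurable_box_sum (h := fun _ _ => 1)) => // x; exact: measurable_cst.
by apply/funext => rho; rewrite NrhoE -sum1_size natr_sum.
Qed.

Lemma measurable_quad_error d (Y : measurableType d) (g : Y * (R * R) -> R) :
  measurable_fun setT g ->
  measurable_fun setT (fun y : Y * (R * R) =>
    quad_error y.2 (box_pts y.2) (Nrho L y.2)^-1 (fun x => g (y.1, x))).
Proof.
move=> mg; apply: measurable_funB.
  apply: (@measurable_box_sum _ _ snd (fun y x => (Nrho L y.2)^-1 * g (y.1, x))) => // x.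
  apply: measurable_funM.
    apply: ge0_measurable_funV => [|y]; last exact: ltW (Nrho_gt0 _).
    exact: (measurableT_comp measurable_Nrho).
  apply: (measurableT_comp mg); apply: measurable_fun_pair => //.
apply: (measurable_Rintegral2 leb2
  (f := fun y => \1_(unit_box y.1.2) y.2 * g (y.1.1, y.2))).
apply: measurable_funM.
  have mp : measurable_fun setT (fun y : Y * (R * R) * (R * R) => (y.1.2, y.2)).
    by apply: measurable_fun_pair => //; exact: measurableT_comp.
  exact: (measurableT_comp measurable_indic_unit_box mp).
have mp : measurable_fun setT (fun y : Y * (R * R) * (R * R) => (y.1.1, y.2)).
  by apply: measurable_fun_pair => //; exact: measurableT_comp.
exact: (measurableT_comp mg mp).
Qed.

(** Since N_rho >= 1, the integrand is at most an indicator of integral 1. The weights are thus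
    finite and [fine] keeps their value. *)
Lemma aweight_le1 l : (0 <= aweight L l <= 1)%E.
Proof.
have N0 rho : 0 <= \1_(unit_box rho) l / Nrho L rho :> R.
  by rewrite divr_ge0 ?indicE ?ler0n// ltW// Nrho_gt0.
apply/andP; split; first by apply: integral_ge0 => rho _; rewrite lee_fin.
rewrite -(integral_unit_box l) /aweight; apply: ge0_le_integral_lower => rho.
  by rewrite lee_fin.
by rewrite lee_fin ler_piMr ?indicE// invf_le1 ?Nrho_gt0.
Qed.

(** The enumeration turns the sum over [L] into a series of nonnegative terms, which can be
    exchanged with the [rho]-integral defining the weights; at each [rho] the series is then a
    finite sum. *)
Lemma esum_aweight (F : R * R -> R) :
  (forall x, 0 <= F x) ->
  (\esum_(l in L) (fine (aweight L l) * F l)%:E =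
   \int[leb2]_rho (\sum_(x <- box_pts rho) (Nrho L rho)^-1 * F x)%:E)%E.
Proof.
move=> F0.
have a0 k : (0 <= (fine (aweight L (e k)) * F (e k))%:E)%E.
  by rewrite lee_fin mulr_ge0// fine_ge0//; case/andP: (aweight_le1 (e k)).
have N0 rho : 0 <= (Nrho L rho)^-1 by rewrite invr_ge0 ltW// Nrho_gt0.
rewrite (@reindex_esum _ _ _ _ _ _ _ e_bij) -nneseries_esumT//.
pose f k rho := (\1_(unit_box rho) (e k) / Nrho L rho * F (e k))%:E.
have mf k : measurable_fun setT (fun rho => \1_(unit_box rho) (e k) / Nrho L rho : R).
  apply: measurable_funM.
    apply: measurable_indic_box => //; do ?[exact: measurable_cst|exact: measurable_fst|exact: measurable_snd].
  apply: ge0_measurable_funV => [|y]; last exact: ltW (Nrho_gt0 _).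
  exact: measurable_Nrho.
have f0 k rho : (0 <= f k rho)%E.
  by rewrite lee_fin mulr_ge0// mulr_ge0// indicE.
transitivity (\sum_(k <oo) \int[leb2]_rho f k rho)%E.
  apply: eq_eseriesr => k _.
  rewrite EFinM fineK; last first.
    have /andP[ak0 ak1] := aweight_le1 (e k).
    by rewrite ge0_fin_numE// (le_lt_trans ak1)// ltry.
  under [RHS]eq_integral do rewrite /f EFinM.
  rewrite ge0_integralZr//; last by rewrite lee_fin.
    by apply/measurable_EFinP; exact: mf.
  by move=> rho _; rewrite lee_fin mulr_ge0// indicE.
rewrite -integral_nneseries//; last first.
  by move=> k; apply/measurable_EFinP; apply: measurable_funM; [exact: mf|exact: measurable_cst].
apply: eq_integral => rho _.
have [n0 n0P] := sum_box_enum rho.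
apply/cvg_lim => //; apply: cvg_near_cst; exists n0 => // n /= n0n.
rewrite big_mkord sumEFin; congr EFin.
rewrite -(n0P n n0n (fun x => (Nrho L rho)^-1 * F x)).
by apply: eq_bigr => k _; rewrite mulrA.
Qed.

End points.

(** * The sampling error *)

Section linear_combination.
Context {R : realType}.
Implicit Types (a b : R).

Lemma derive1_lincomb (u v : R -> R) a b t : derivable u t 1 -> derivable v t 1 ->
  derivable (fun s => a * u s - b * v s) t 1 /\
  derive1 (fun s => a * u s - b * v s) t = a * derive1 u t - b * derive1 v t.
Proof.
move=> du dv.
have dau : derivable (a \*: u) t 1 by exact: derivableZ.
have dbv : derivable (b \*: v) t 1 by exact: derivableZ.
have E : 'D_1 ((a \*: u) - (b \*: v)) t = a *: 'D_1 u t - b *: 'D_1 v t.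
  by rewrite (deriveB dau dbv) (deriveZ a du) (deriveZ b dv).
split; first exact: (derivableB dau dbv).
by move: E; rewrite -!derive1E; exact.
Qed.

(** The combination a * u - b * v is the real part of (a + ib)(u + iv), the form in which
    [frame_kernel] depends on K. *)
Lemma cont_mixed_lincomb (u v : R * R -> R) a b :
  cont_mixed_partials u -> cont_mixed_partials v ->
  let g p := a * u p - b * v p in
  [/\ cont_mixed_partials g, pd1 g = (fun p => a * pd1 u p - b * pd1 v p),
      pd2 g = (fun p => a * pd2 u p - b * pd2 v p) &
      pd12 g = (fun p => a * pd12 u p - b * pd12 v p)].
Proof.
move=> [u1 [u2 [u12 [cu1 [cu2 cu12]]]]] [v1 [v2 [v12 [cv1 [cv2 cv12]]]]] g.
have L1 p := derive1_lincomb a b (u1 p) (v1 p).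
have L2 p := derive1_lincomb a b (u2 p) (v2 p).
have L12 p := derive1_lincomb a b (u12 p) (v12 p).
have g1 : pd1 g = (fun p => a * pd1 u p - b * pd1 v p).
  by apply/funext => p; exact: (L1 p).2.
have g2 : pd2 g = (fun p => a * pd2 u p - b * pd2 v p).
  by apply/funext => p; exact: (L2 p).2.
have g12 : pd12 g = (fun p => a * pd12 u p - b * pd12 v p).
  by rewrite /pd12 g1; apply/funext => p; exact: (L12 p).2.
have cl (h k : R * R -> R) : continuous h -> continuous k ->
    continuous (fun p => a * h p - b * k p).
  move=> ch ck p; apply: cvgB; (apply: cvgM; first exact: cvg_cst).
    exact: ch.
  exact: ck.
split; [|exact: g1|exact: g2|exact: g12].
split; first by move=> p; exact: (L1 p).1.
split; first by move=> p; exact: (L2 p).1.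
split; first by rewrite g1 => p; exact: (L12 p).1.
split; first by rewrite g1; exact: cl.
by split; [rewrite g2|rewrite g12]; exact: cl.
Qed.

End linear_combination.

Section kernel_bounds.
Context {R : realType} (H : lmodType R[i]) (ip : H -> H -> R[i]) (psi : R * R -> H).
Hypotheses (ipH : inner_product ip) (sepH : ip_separable ip).
Hypothesis frame : continuous_parseval_frame ip psi.
Variable f : H.
Local Notation T := (R * R)%type.
Local Notation K := (Kker ip psi).
Local Notation g := (frame_kernel ip psi f).

Definition coef_abs (eta : T) : R := Num.sqrt (cabs2 (ip f (psi eta))).

(** The integrand of [Omega]. *)
Definition kernel_L1 (eta nu : T) : \bar R :=
  (L1norm (cpd_abs pd1 (K eta nu)) + L1norm (cpd_abs pd2 (K eta nu)) +
   L1norm (cpd_abs pd12 (K eta nu)))%E.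

Lemma L1norm_ge0 (h : T -> R) : (0 <= L1norm h)%E.
Proof. by rewrite /L1norm; apply: integral_ge0 => x _; rewrite lee_fin. Qed.

Lemma kernel_L1_ge0 eta nu : (0 <= kernel_L1 eta nu)%E.
Proof.
exact: (adde_ge0 (adde_ge0 (L1norm_ge0 _) (L1norm_ge0 _)) (L1norm_ge0 _)).
Qed.

Lemma L1norm_le_scale (h k : T -> R) (c : R) : 0 <= c -> measurable_fun setT k ->
  (forall p, `|h p| <= c * `|k p|) -> (L1norm h <= c%:E * L1norm k)%E.
Proof.
move=> c0 mk hk.
have E : (\int[leb2]_p (c%:E * `|k p|%:E) = c%:E * L1norm k)%E.
  apply: ge0_integralZl_EFin => //.
  by apply/measurable_EFinP; exact: measurableT_comp.
rewrite -E; apply: ge0_le_integral_lower => x; first by rewrite lee_fin.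
by rewrite -EFinM lee_fin.
Qed.

Lemma L1norm_lincomb_le (u v : T -> R) (a b : R) : continuous u -> continuous v ->
  (L1norm (fun p => a * u p - b * v p)%R <=
   (Num.sqrt (a ^+ 2 + b ^+ 2)%R)%:E * L1norm (fun p => Num.sqrt (u p ^+ 2 + v p ^+ 2)%R))%E.
Proof.
move=> cu cv; apply: L1norm_le_scale => //.
  have ms : measurable_fun setT (Num.sqrt : R -> R).
    by apply: continuous_measurable_fun; exact: sqrt_continuous.
  have mi : measurable_fun setT (fun p => u p ^+ 2 + v p ^+ 2).
    by apply: measurable_funD; apply: measurable_funX; exact: continuous_measurable_fun2.
  exact: (measurableT_comp ms mi).
move=> p; rewrite (ger0_norm (sqrtr_ge0 (u p ^+ 2 + v p ^+ 2))).
rewrite -(sqrtrM _ (addr_ge0 (sqr_ge0 a) (sqr_ge0 b))) -sqrtr_sqr; apply: ler_wsqrtr.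
(* Lagrange's identity: (a^2 + b^2)(u^2 + v^2) = (au - bv)^2 + (av + bu)^2. *)
have := sqr_ge0 (a * v p + b * u p); nra.
Qed.

Lemma kernel_variation_le eta nu : ccont_mixed_partials (K eta nu) ->
  cont_mixed_partials (g (eta, nu)) /\
  (\int[leb2]_rho box_variation (pd1 (g (eta, nu))) (pd2 (g (eta, nu)))
      (pd12 (g (eta, nu))) rho <= (coef_abs eta * coef_abs nu)%:E * kernel_L1 eta nu)%E.
Proof.
move=> [cr ci].
pose c := ip f (psi nu) * (ip f (psi eta))^*.
have [cg g1 g2 g12] := cont_mixed_lincomb (cRe c) (cIm c) cr ci.
have gE : g (eta, nu) = fun p => cRe c * cRe (K eta nu p) - cIm c * cIm (K eta nu p).
  by apply/funext => p; rewrite /frame_kernel cReM.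
have [_ [_ [_ [r1 [r2 r12]]]]] := cr; have [_ [_ [_ [i1 [i2 i12]]]]] := ci.
rewrite gE; split => //.
have [_ [_ [_ [c1 [c2 c12]]]]] := cg.
rewrite integral_box_variation; [|exact: continuous_measurable_fun2..].
have cE : coef_abs eta * coef_abs nu = Num.sqrt (cRe c ^+ 2 + cIm c ^+ 2).
  rewrite -[_ + _]/(cabs2 c) cabs2M cabs2_conj mulrC /coef_abs sqrtrM//.
  exact: cabs2_ge0.
rewrite cE /kernel_L1 g1 g2 g12.
have L0 := L1norm_ge0.
rewrite (ge0_muleDr _ (adde_ge0 (L0 _) (L0 _)) (L0 _)) (ge0_muleDr _ (L0 _) (L0 _)).
by apply: leeD; [apply: leeD|]; exact: L1norm_lincomb_le.
Qed.

End kernel_bounds.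

Lemma ae_mono d (T : measurableType d) (R : realType)
    (mu : {measure set T -> \bar R}) (P Q : T -> Prop) :
  (forall x, P x -> Q x) -> (\forall x \ae mu, P x) -> \forall x \ae mu, Q x.
Proof. by move=> PQ; apply: filterS. Qed.

Lemma integral_indic_unit_box (R : realType) (rho : R * R) :
  (\int[leb2]_x (\1_(unit_box rho) x : R)%:E = 1)%E.
Proof.
have ms := @measurable_shifted_box R rho (1, 1).
rewrite integral_indic// setIT.
have := @leb2_shifted_box R rho (1, 1) ler01 ler01.
by rewrite mulr1; exact.
Qed.

Section sampling.
Context {R : realType} (H : lmodType R[i]) (ip : H -> H -> R[i]) (psi : R * R -> H).
Hypotheses (ipH : inner_product ip) (sepH : ip_separable ip).
Hypothesis frame : continuous_parseval_frame ip psi.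
Variables (L : set (R * R)) (e : nat -> R * R).
Hypothesis finL : forall rho : R * R, finite_set (L `&` unit_box rho).
Hypothesis NL : forall rho : R * R, 1 <= Nrho L rho.
Hypothesis e_bij : set_bij [set: nat] L e.
Hypothesis good : \forall nu \ae leb2, \forall eta \ae leb2,
  ccont_mixed_partials (Kker ip psi eta nu).
Variables (D O : R).
Hypotheses (D0 : 0 < D) (LD : (Dshift L <= D%:E)%E) (LO : (Omega ip psi <= O%:E)%E).
Variable f : H.
Local Notation T := (R * R)%type.
Local Notation g := (frame_kernel ip psi f).
Local Notation m := (sigma_prod leb2 leb2).
Local Notation p := (coef_abs ip psi f).

Definition sample_error (z : T * T) (rho : T) : R :=
  quad_error rho (box_pts L rho) (Nrho L rho)^-1 (g z).

Definition box_oscillation (z : T * T) (rho : T) : \bar R :=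
  (\int[leb2]_x (\1_(unit_box rho) x * `|g z x - g z (rho.1 + 1, rho.2 + 1)|)%:E)%E.

(** Dividing the error by [D] puts it under the same bound as the oscillation, so that
    [schur_kernel] serves both. *)
Lemma error_good_pair eta nu : ccont_mixed_partials (Kker ip psi eta nu) ->
  (\int[leb2]_rho (D^-1 * `|sample_error (eta, nu) rho|)%:E <=
     (p eta * p nu)%:E * kernel_L1 ip psi eta nu)%E /\
  (\int[leb2]_rho box_oscillation (eta, nu) rho <=
     (p eta * p nu)%:E * kernel_L1 ip psi eta nu)%E.
Proof.
move=> K; have [cg gle] := kernel_variation_le f K.
have kh rho := koksma_hlawka cg (fun x xl => ((mem_box_pts finL rho x).1 xl).2)
  (sum_box_weight NL rho) (discrepancy_le_Dshift finL rho LD).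
split; apply: le_trans gle; apply: ge0_le_integral_lower => rho.
- by rewrite lee_fin mulr_ge0// invr_ge0 ltW.
- by rewrite EFinM lee_pdivrMl//; exact: (kh rho).2.
- by apply: integral_ge0 => x _; rewrite lee_fin mulr_ge0// indicE.
have V0 : (0 <= box_variation (pd1 (g (eta, nu))) (pd2 (g (eta, nu)))
    (pd12 (g (eta, nu))) rho)%E.
  (* The variation is nonnegative because it bounds the oscillation at the point [rho] of the
     box. *)
  have bx : unit_box rho rho by split; rewrite /= lexx lerDl ler01.
  by apply: le_trans ((kh rho).1 rho bx); rewrite lee_fin.
have [V VE] : exists V, V = box_variation (pd1 (g (eta, nu))) (pd2 (g (eta, nu)))
    (pd12 (g (eta, nu))) rho by eexists.
have kV := (kh rho).1; rewrite -VE in V0 kV *.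
apply: (@le_trans _ _ (\int[leb2]_x (V * (\1_(unit_box rho) x : R)%:E))%E).
  apply: ge0_le_integral_lower => x.
    by rewrite lee_fin mulr_ge0// indicE.
  rewrite indicE; case: (boolP (x \in _)) => [/set_mem xb|_].
    by rewrite mul1r mule1; exact: kV.
  by rewrite mul0r mule0.
have ms := @measurable_shifted_box R rho (1, 1).
have E : (\int[leb2]_x (V * (\1_(unit_box rho) x : R)%:E) =
    V * \int[leb2]_x (\1_(unit_box rho) x : R)%:E)%E.
  apply: ge0_integralZl => //; first by apply/measurable_EFinP; exact: measurable_indic.
by rewrite E integral_indic_unit_box mule1.
Qed.

(** After Tonelli's theorem has moved the [rho]-integral inside, [schur_test] applies with p = |<f,
    psi>|, whose square integrates to |f|^2 by Parseval. *)
Lemma schur_kernel (Phi : (T * T) * T -> \bar R) :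
  measurable_fun setT Phi -> (forall y, (0 <= Phi y)%E) ->
  (forall eta nu rho, Phi ((eta, nu), rho) = Phi ((nu, eta), rho)) ->
  (forall eta nu, ccont_mixed_partials (Kker ip psi eta nu) ->
    \int[leb2]_rho Phi ((eta, nu), rho) <= (p eta * p nu)%:E * kernel_L1 ip psi eta nu)%E ->
  measurable_fun setT (fun rho => \int[m]_z Phi (z, rho))%E /\
  (\int[leb2]_rho \int[m]_z Phi (z, rho) <= (O * cRe (ip f f))%:E)%E.
Proof.
move=> mPhi Phi0 Phisym Phile; split.
  exact: (measurable_fun_fubini_tonelli_G (m1 := m) Phi mPhi Phi0).
rewrite -[leLHS](fubini_tonelli (m1 := m) (m2 := leb2) Phi mPhi Phi0).
have mp : measurable_fun setT p.
  have ms : measurable_fun setT (Num.sqrt : R -> R).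
    by apply: continuous_measurable_fun; exact: sqrt_continuous.
  exact: (measurableT_comp ms (measurable_cabs2 (cmeasurable_frame frame f))).
have p0 x : 0 <= p x by exact: sqrtr_ge0.
have mF := measurable_fun_fubini_tonelli_F (m2 := leb2) Phi mPhi Phi0.
have F0 z : (0 <= fubini_F leb2 Phi z)%E by exact: integral_ge0.
have Fsym x y : fubini_F leb2 Phi (x, y) = fubini_F leb2 Phi (y, x).
  by apply: eq_integral => rho _; exact: Phisym.
have W0 := @kernel_L1_ge0 R H ip psi.
have := @schur_test _ _ R leb2 p (fubini_F leb2 Phi) (kernel_L1 ip psi) O%:E
  mp p0 mF F0 Fsym W0.
have -> : (\int[leb2]_x (p x ^+ 2)%:E = (cRe (ip f f))%:E)%E.
  have [pi pe] := parseval ipH frame f.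
  rewrite -pe EFin_Rintegral//; apply: eq_integral => x _.
  by rewrite /coef_abs sqr_sqrtr// cabs2_ge0.
rewrite -EFinM; apply.
- apply: (ae_mono (mu := leb2) _ good) => nu.
  by apply: (ae_mono (mu := leb2)) => eta; exact: Phile.
(* The eta-integral is below its essential supremum [Omega] for almost every nu; eta is the variable
   x of [schur_test] and nu is y. *)
- have h := ess_sup_ge leb2 (fun nu => \int[leb2]_eta kernel_L1 ip psi eta nu)%E.
  by apply: (ae_mono (mu := leb2) _ h) => nu hn; exact: le_trans hn LO.
Qed.

Lemma measurable_sample_error :
  measurable_fun setT (fun y : (T * T) * T => sample_error y.1 y.2).
Proof.
exact: (measurable_quad_error finL NL e_bij (measurable_frame_kernel ipH sepH frame f)).
Qed.

Lemma measurable_corner_difference : measurable_fun setT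
  (fun y : ((T * T) * T) * T => \1_(unit_box y.1.2) y.2 *
     `|g y.1.1 y.2 - g y.1.1 (y.1.2.1 + 1, y.1.2.2 + 1)|).
Proof.
have mg := measurable_frame_kernel ipH sepH frame f.
have m112 : measurable_fun setT (fun y : ((T * T) * T) * T => y.1.2).
  exact: measurableT_comp.
have m111 : measurable_fun setT (fun y : ((T * T) * T) * T => y.1.1).
  exact: measurableT_comp.
have mc : measurable_fun setT
    (fun y : ((T * T) * T) * T => (y.1.1, (y.1.2.1 + 1, y.1.2.2 + 1))).
  apply: measurable_fun_pair => //; apply: measurable_fun_pair; apply: measurable_funD;
    try exact: measurable_cst.
  - exact: (measurableT_comp measurable_fst m112).
  - exact: (measurableT_comp measurable_snd m112).
have mb : measurable_fun setT (fun y : ((T * T) * T) * T => (y.1.2, y.2)).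
  exact: measurable_fun_pair.
have mx : measurable_fun setT (fun y : ((T * T) * T) * T => (y.1.1, y.2)).
  exact: measurable_fun_pair.
apply: measurable_funM; first exact: (measurableT_comp measurable_indic_unit_box mb).
apply: measurableT_comp => //; apply: measurable_funB.
- exact: (measurableT_comp mg mx).
- exact: (measurableT_comp mg mc).
Qed.

Lemma measurable_box_oscillation :
  measurable_fun setT (fun y : (T * T) * T => box_oscillation y.1 y.2).
Proof.
have mE : measurable_fun setT (fun y : ((T * T) * T) * T => (\1_(unit_box y.1.2) y.2 *
     `|g y.1.1 y.2 - g y.1.1 (y.1.2.1 + 1, y.1.2.2 + 1)|)%:E).
  by apply/measurable_EFinP; exact: measurable_corner_difference.
exact: (measurable_integral2 leb2 mE).
Qed.

Lemma box_oscillation_ge0 z rho : (0 <= box_oscillation z rho)%E.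
Proof. by apply: integral_ge0 => x _; rewrite lee_fin mulr_ge0// indicE. Qed.

Lemma sample_error_sym eta nu rho : sample_error (eta, nu) rho = sample_error (nu, eta) rho.
Proof.
rewrite /sample_error; congr (quad_error _ _ _ _); apply/funext => x.
exact: frame_kernel_sym.
Qed.

Lemma box_oscillation_sym eta nu rho :
  box_oscillation (eta, nu) rho = box_oscillation (nu, eta) rho.
Proof.
by apply: eq_integral => x _; congr (_ * `|_ - _|)%:E; exact: frame_kernel_sym.
Qed.

Lemma total_error_le :
  measurable_fun setT (fun rho => \int[m]_z `|sample_error z rho|%:E)%E /\
  (\int[leb2]_rho \int[m]_z `|sample_error z rho|%:E <= (D * (O * cRe (ip f f)))%:E)%E.
Proof.
pose Phi (y : (T * T) * T) := (D^-1 * `|sample_error y.1 y.2|)%:E.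
have mS : measurable_fun setT (fun y : (T * T) * T => `|sample_error y.1 y.2|).
  by apply: measurableT_comp => //; exact: measurable_sample_error.
have mPhi : measurable_fun setT Phi.
  apply/measurable_EFinP; apply: measurable_funM; [exact: measurable_cst|exact: mS].
have Phi0 y : (0 <= Phi y)%E by rewrite lee_fin mulr_ge0// invr_ge0 ltW.
have [mP leP] := schur_kernel mPhi Phi0
  (fun eta nu rho => congr1 (fun r => (D^-1 * `|r|)%:E) (sample_error_sym eta nu rho))
  (fun eta nu K => (error_good_pair K).1).
have E rho : (\int[m]_z `|sample_error z rho|%:E = D%:E * \int[m]_z Phi (z, rho))%E.
  have <- : (\int[m]_z (D%:E * Phi (z, rho)) = D%:E * \int[m]_z Phi (z, rho))%E.
    apply: ge0_integralZl_EFin => //; last exact: ltW.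
    by apply: (measurableT_comp mPhi); exact: measurable_pair2.
  by apply: eq_integral => z _; rewrite /Phi -EFinM mulrA mulfV ?mul1r// gt_eqF.
have EE : (fun rho => \int[m]_z `|sample_error z rho|%:E)%E =
    (fun rho => D%:E * \int[m]_z Phi (z, rho))%E by apply/funext.
split.
  by rewrite EE; apply: emeasurable_funM; [exact: measurable_cst|exact: mP].
have -> : (\int[leb2]_rho \int[m]_z `|sample_error z rho|%:E =
    D%:E * \int[leb2]_rho \int[m]_z Phi (z, rho))%E.
  transitivity (\int[leb2]_rho (D%:E * \int[m]_z Phi (z, rho)))%E.
    by apply: eq_integral => rho _; exact: E.
  apply: ge0_integralZl_EFin => //; last exact: ltW.
  by move=> rho _; exact: integral_ge0.
rewrite EFinM; apply: lee_wpmul2l; [by rewrite lee_fin ltW|exact: leP].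
Qed.

Lemma ae_box_oscillation_finite :
  \forall rho \ae leb2, (\int[m]_z box_oscillation z rho < +oo)%E.
Proof.
have [mP leP] := schur_kernel measurable_box_oscillation
  (fun y => box_oscillation_ge0 y.1 y.2)
  box_oscillation_sym
  (fun eta nu K => (error_good_pair K).2).
have i : leb2.-integrable setT (fun rho => \int[m]_z box_oscillation z rho)%E.
  apply/integrableP; split; first exact: mP.
  apply: le_lt_trans (ltry (O * cRe (ip f f))); apply: le_trans leP.
  apply: ge0_le_integral_lower => rho; first exact: abse_ge0.
  by rewrite gee0_abs//; apply: integral_ge0 => z _; exact: box_oscillation_ge0.
have := integrable_ae measurableT i.
apply: (ae_mono (mu := leb2)) => rho /(_ I).
by rewrite ge0_fin_numE//; apply: integral_ge0 => z _; exact: box_oscillation_ge0.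
Qed.

Let F x := cabs2 (ip f (psi x)).
Local Notation w rho := (Nrho L rho)^-1.

(** By linearity and [frame_kernel_repr], the error of F is the integral over all pairs of the
    errors of the kernels, once Fubini's theorem may be applied to the box integral. *)
Lemma quad_error_frame rho : (\int[m]_z box_oscillation z rho < +oo)%E ->
  leb2.-integrable setT (EFin \o (fun x => \1_(unit_box rho) x * F x)) /\
  (`|quad_error rho (box_pts L rho) (w rho) F|%:E <=
     \int[m]_z `|sample_error z rho|%:E)%E.
Proof.
move=> Afin.
set b := (rho.1 + 1, rho.2 + 1).
have repr x := frame_kernel_repr ipH sepH frame f x.
pose h (y : (T * T) * T) := \1_(unit_box rho) y.2 * g y.1 y.2.
have mg := measurable_frame_kernel ipH sepH frame f.
have mh : measurable_fun setT h.
  apply: measurable_funM; last exact: mg.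
  have mb : measurable_fun setT (\1_(unit_box rho) : T -> R).
    by apply: measurable_indic; exact: measurable_shifted_box.
  exact: (measurableT_comp mb).
have mgb : measurable_fun setT (fun z => `|g z b|%:E).
  apply/measurable_EFinP; apply: measurableT_comp => //.
  by have := measurableT_comp mg (measurable_pair2 b); exact.
have mosc : measurable_fun setT (fun z => box_oscillation z rho).
  by have := measurableT_comp measurable_box_oscillation (measurable_pair2 rho); exact.
have ih : (sigma_prod m leb2).-integrable setT (EFin \o h).
  apply/(integrable12ltyP m leb2); first exact/measurable_EFinP.
  (* The kernel at x is at most its difference from the corner value plus that value. The corner
     value is integrable over pairs by [frame_kernel_repr] at the single point [b], and the box has
     area 1. *)
  apply: (@le_lt_trans _ _ (\int[m]_z (box_oscillation z rho + `|g z b|%:E))%E).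
    apply: ge0_le_integral_lower => z; first exact: integral_ge0.
    have m1 : measurable_fun setT (fun x : T => (\1_(unit_box rho) x : R)%:E).
      by apply/measurable_EFinP; apply: measurable_indic; exact: measurable_shifted_box.
    have mo : measurable_fun setT (fun x => (\1_(unit_box rho) x * `|g z x - g z b|)%:E).
      apply/measurable_EFinP.
      by have := measurableT_comp measurable_corner_difference (measurable_pair1 (z, rho)); exact.
    have e1 : (\int[leb2]_x (`|g z b|%:E * (\1_(unit_box rho) x : R)%:E) = `|g z b|%:E)%E.
      transitivity (`|g z b|%:E * \int[leb2]_x (\1_(unit_box rho) x : R)%:E)%E.
        by apply: ge0_integralZl_EFin => // x _; rewrite lee_fin.
      by rewrite integral_indic_unit_box mule1.
    have e2 : (\int[leb2]_x ((\1_(unit_box rho) x * `|g z x - g z b|)%:E +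
        `|g z b|%:E * (\1_(unit_box rho) x : R)%:E) = box_oscillation z rho + `|g z b|%:E)%E.
      rewrite -[X in (_ + X)%E]e1; apply: ge0_integralD.
      - exact: measurableT.
      - by move=> x _; rewrite lee_fin mulr_ge0// indicE.
      - exact: mo.
      - by move=> x _; rewrite -EFinM lee_fin mulr_ge0// indicE.
      - by apply: emeasurable_funM; [exact: measurable_cst|exact: m1].
    rewrite -e2; apply: ge0_le_integral_lower => x; first exact: abse_ge0.
    rewrite /h /= -EFinM -EFinD lee_fin normrM indicE.
    case: (x \in _); last by rewrite normr0 !mul0r mulr0 addr0.
    rewrite normr1 !mul1r mulr1.
    have -> : `|g z x| = `|(g z x - g z b) + g z b| by rewrite subrK.
    exact: ler_normD.
  have -> : (\int[m]_z (box_oscillation z rho + `|g z b|%:E) =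
      \int[m]_z box_oscillation z rho + \int[m]_z `|g z b|%:E)%E.
    apply: ge0_integralD => //.
    by move=> z _; exact: box_oscillation_ge0.
  by apply: lte_add_pinfty => //; case/integrableP : (repr b).1.
have [i1 i2 e1 e2] := Rintegral_fubini ih.
have FE x : \int[m]_z h (z, x) = \1_(unit_box rho) x * F x.
  by rewrite /F -(repr x).2; exact: (RintegralZl (\1_(unit_box rho) x) measurableT (repr x).1).
have i2' : leb2.-integrable setT (EFin \o (fun x => \1_(unit_box rho) x * F x)).
  by apply: eq_integrable i2 => // x _ /=; rewrite FE.
split => //.
have [si se] := Rintegral_sum (box_pts L rho) (w rho) (fun x => (repr x).1).
have qE : quad_error rho (box_pts L rho) (w rho) F = \int[m]_z sample_error z rho.
  have -> : \int[m]_z sample_error z rho =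
     \int[m]_z (\sum_(x <- box_pts L rho) w rho * g z x) - \int[m]_z \int[leb2]_x h (z, x).
    by rewrite -(RintegralB measurableT si i1).
  rewrite -se; congr (_ - _).
    by apply: eq_bigr => x _; rewrite (repr x).2.
  transitivity (\int[leb2]_x \int[m]_z h (z, x)); last by rewrite -e2 e1.
  by apply: eq_Rintegral => x _; rewrite FE.
have iE : m.-integrable setT (EFin \o sample_error ^~ rho).
  exact: (integrableB measurableT si i1).
rewrite qE.
have iaE : m.-integrable setT (EFin \o (fun z => `|sample_error z rho|)).
  exact: (integrable_abse iE).
rewrite -(EFin_Rintegral iaE) lee_fin.
exact: (le_normr_Rintegral measurableT iE).
Qed.

Lemma sampling_bounds :
  (\esum_(l in L) (fine (aweight L l) * F l)%:E <=
     (cRe (ip f f) + D * (O * cRe (ip f f)))%:E)%E /\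
  ((cRe (ip f f))%:E <= \esum_(l in L) (fine (aweight L l) * F l)%:E +
     (D * (O * cRe (ip f f)))%:E)%E.
Proof.
have F0 x : 0 <= F x by exact: cabs2_ge0.
have w0 rho : 0 <= w rho by rewrite invr_ge0; exact: ltW (Nrho_gt0 NL rho).
rewrite (esum_aweight finL NL e_bij F0).
pose S rho : \bar R := (\sum_(x <- box_pts L rho) w rho * F x)%:E.
pose I rho : \bar R := (\int[leb2]_x ((\1_(unit_box rho) x)%:E * (F x)%:E))%E.
pose G rho : \bar R := (\int[m]_z `|sample_error z rho|%:E)%E.
have S0 rho : (0 <= S rho)%E.
  by rewrite lee_fin; apply: sumr_ge0 => x _; rewrite mulr_ge0.
have I0 rho : (0 <= I rho)%E.
  by apply: integral_ge0 => x _; rewrite -EFinM lee_fin mulr_ge0// indicE.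
have G0 rho : (0 <= G rho)%E by apply: integral_ge0 => z _; rewrite lee_fin.
have mS : measurable_fun setT S.
  apply/measurable_EFinP.
  apply: (measurable_box_sum finL e_bij (r := id) (h := fun y x => w y * F x)) => // x.
  apply: measurable_funM; last exact: measurable_cst.
  apply: ge0_measurable_funV => [|y]; last exact: ltW (Nrho_gt0 NL y).
  exact: (measurable_Nrho finL e_bij).
have mF : measurable_fun setT (fun x => (F x)%:E).
  by apply/measurable_EFinP; apply: measurable_cabs2; exact: (cmeasurable_frame frame f).
have F0e x : (0 <= (F x)%:E)%E by rewrite lee_fin.
have [mI eI] := integral_unit_kernel (mu := leb2) measurable_indic_unit_box
  (fun z => indicE_ge0 _ _ _) integral_unit_box mF F0e.
have {}eI : (\int[leb2]_rho I rho = (cRe (ip f f))%:E)%E.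
  have [pi pe] := parseval ipH frame f.
  by apply: (eq_trans eI); rewrite -pe (EFin_Rintegral pi).
have [mG leG] := total_error_le.
(* The bound |S - I| <= G is written as two inequalities between nonnegative sums, so that no
   difference of possibly infinite integrals arises. *)
have key : \forall rho \ae leb2, (S rho <= I rho + G rho)%E /\ (I rho <= S rho + G rho)%E.
  apply: (ae_mono (mu := leb2) _ ae_box_oscillation_finite) => rho /quad_error_frame[iF].
  rewrite -/(G rho) /quad_error => qG.
  have -> : I rho = (\int[leb2]_x (\1_(unit_box rho) x * F x))%:E.
    by rewrite (EFin_Rintegral iF).
  move: qG; rewrite /S; move: (\sum_(x <- _) _) (Rintegral _ _ _) => a b qG.
  split; apply: (@le_trans _ _ (_ + `|a - b|%:E)%E); try exact: (leeD2l _ qG).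
    by rewrite -EFinD lee_fin -lerBlDl ler_norm.
  by rewrite -EFinD lee_fin -lerBlDl distrC ler_norm.
have IGE : (\int[leb2]_rho (I rho + G rho) = \int[leb2]_rho I rho + \int[leb2]_rho G rho)%E.
  by apply: ge0_integralD.
have SGE : (\int[leb2]_rho (S rho + G rho) = \int[leb2]_rho S rho + \int[leb2]_rho G rho)%E.
  by apply: ge0_integralD.
split.
  apply: (@le_trans _ _ (\int[leb2]_rho (I rho + G rho))%E).
    apply: ae_ge0_le_integral_lower => // [rho|]; first exact: adde_ge0.
    by apply: (ae_mono (mu := leb2) _ key) => rho [].
  by rewrite IGE eI EFinD; exact: leeD2l.
rewrite -eI; apply: (@le_trans _ _ (\int[leb2]_rho (S rho + G rho))%E).
  apply: ae_ge0_le_integral_lower => // [rho|]; first exact: adde_ge0.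
  by apply: (ae_mono (mu := leb2) _ key) => rho [].
by rewrite SGE; exact: leeD2l.
Qed.

End sampling.

(** For a zero measure the essential supremum would be -oo, even for a nonnegative function;
    [Omega_ge0] rests on excluding this. *)
Lemma leb2_setT_gt0 (R : realType) : (0 < leb2 [set: R * R])%E.
Proof.
have h := @leb2_shifted_box R (0, 0) (1, 1) ler01 ler01.
apply: (@lt_le_trans _ _ (leb2 (unit_box (0, 0) : set (R * R)))).
  by rewrite /unit_box h mulr1 lte_fin ltr01.
apply: (le_measure leb2); last by [].
  by apply: mem_set; exact: measurable_shifted_box.
by apply: mem_set; exact: measurableT.
Qed.

Lemma Omega_ge0 (R : realType) (H : lmodType R[i]) (ip : H -> H -> R[i])
  (psi : R * R -> H) : (0 <= Omega ip psi)%E.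
Proof.
apply: (ess_sup_gee (mu := leb2)); first exact: leb2_setT_gt0.
apply: (ae_mono (mu := leb2) (P := fun _ => True)).
  by move=> nu _; apply: integral_ge0 => eta _; exact: kernel_L1_ge0.
by exists set0; split => // x; apply.
Qed.

Theorem theorem2 (R : realType) (H : lmodType R[i]) (ip : H -> H -> R[i])
  (psi : R * R -> H) (L : set (R * R)) :
  hilbert_space ip ->
  continuous_parseval_frame ip psi ->
  (* K^(eta,nu) has continuous mixed partials for almost all nu, eta *)
  (\forall nu \ae leb2, \forall eta \ae leb2,
      ccont_mixed_partials (Kker ip psi eta nu)) ->
  (* L is discrete: every [0,1]^2 + rho meets L in finitely many, and
     at least one, points (N_rho >= 1) *)
  (forall rho : R * R, finite_set (L `&` unit_box rho)) ->
  (forall rho : R * R, 1 <= Nrho L rho) ->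
  (Dshift L * Omega ip psi < 1)%E ->
  discrete_frame ip L
    (fun l => ((Num.sqrt (fine (aweight L l)))%:C)%C *: psi l)
    (1 - Dshift L * Omega ip psi)%E
    (1 + Dshift L * Omega ip psi)%E.
Proof.
move=> [ipH _ sepH] frame good finL NL DO1 f.
have [e e_bij] := exists_enum_points finL NL.
have D0 := Dshift_gt0 finL NL.
have Dfin : Dshift L \is a fin_num.
  by rewrite ge0_fin_numE ?ltW// (le_lt_trans (Dshift_le1 finL NL))// ltry.
have O0 := Omega_ge0 ip psi.
(* As [Dshift L] is positive, an infinite [Omega] would make the product infinite, against the bound
   by 1. *)
have Ofin : Omega ip psi \is a fin_num.
  rewrite ge0_fin_numE// ltNge; apply/negP; rewrite leye_eq => /eqP Oy.
  by move: DO1; rewrite Oy gt0_muley// ltNge leey.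
pose D := fine (Dshift L); pose O := fine (Omega ip psi).
have DE : Dshift L = D%:E by rewrite fineK.
have OE : Omega ip psi = O%:E by rewrite fineK.
have D0' : 0 < D by rewrite -lte_fin -DE.
have DL : (Dshift L <= D%:E)%E by rewrite DE.
have OL : (Omega ip psi <= O%:E)%E by rewrite OE.
have [up low] := sampling_bounds ipH sepH frame finL NL e_bij good D0' DL OL f.
have termE l : cabs2 (ip f (((Num.sqrt (fine (aweight L l)))%:C)%C *: psi l)) =
    fine (aweight L l) * cabs2 (ip f (psi l)).
  rewrite (ipZr ipH) cabs2M cabs2_conj; congr (_ * _).
  rewrite /cabs2 /= expr0n addr0 sqr_sqrtr// fine_ge0//.
  by case/andP: (aweight_le1 NL l).
under eq_esum do rewrite termE.
rewrite sqr_ipnorm// DE OE; set Sm := esum _ _ in up low *.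
have -> : (1 - D%:E * O%:E = (1 - D * O)%:E)%E by [].
have -> : (1 + D%:E * O%:E = (1 + D * O)%:E)%E by [].
split; rewrite -EFinM ?mulrBl ?mulrDl mul1r -mulrA; last exact: up.
by rewrite EFinB leeBlDr.
Qed.
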